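(* Let $k\ge3$, $\theta\in\mathcal{P}(B)$, $s\in V_1\otimes\cdots\otimes V_k$ and $t\in W_1\otimes\cdots\otimes W_k$ complex tensors. Then: (1) $F_\theta(\langle r\rangle)=r$ for every $r\in\mathbb{N}$; (2) $F_\theta(s\oplus t)\ge F_\theta(s)+F_\theta(t)$; (3) $F_\theta(s\otimes t)\ge F_\theta(s)F_\theta(t)$; (4) if $s\unrhd t$ then $F_\theta(s)\ge F_\theta(t)$; (5) $0\le F_\theta(s)\le\prod_{\{S,\overline S\}\in B}\min\{\dim V_S,\dim V_{\overline S}\}^{\theta(\{S,\overline S\})}$.
   Context: All vector spaces are finite-dimensional complex; $[k]=\{1,\dots,k\}$, $\overline S=[k]\setminus S$, $V_S=\bigotimes_{j\in S}V_j$. A bipartition is an unordered pair $\{S,\overline S\}$ with $S,\overline S$ nonempty; $B$ is the set of bipartitions of $[k]$ and $\mathcal{P}(B)$ the probability distributions on $B$. Lower quantum functional: equip each $V_j$ with an inner product; for nonzero $\psi\in V_1\otimes\cdots\otimes V_k$ let $\rho=|\psi\rangle\langle\psi|/\langle\psi|\psi\rangle$ and $\rho_S$ its marginal on $V_S$ (partial trace over $V_{\overline S}$); $H_\theta(\psi)=\sum_{\{S,\overline S\}\in B}\theta(\{S,\overline S\})H(\rho_S)$ with $H(\rho)=-\operatorname{Tr}\rho\log_2\rho$ (the entropies of $\rho_S$ and $\rho_{\overline S}$ agree). Then $E_\theta(t)=\sup_{A_j\in\mathrm{GL}(V_j)}H_\theta((A_1\otimes\cdots\otimes A_k)t)$ for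 $t\ne0$, $E_\theta(0)=-\infty$, and $F_\theta(t)=2^{E_\theta(t)}$, $F_\theta(0)=0$ (independent of the inner products). $s\oplus t\in(V_1\oplus W_1)\otimes\cdots\otimes(V_k\oplus W_k)$ and $s\otimes t\in(V_1\otimes W_1)\otimes\cdots\otimes(V_k\otimes W_k)$ are defined naturally; $\langle r\rangle=\sum_{i=1}^re_i\otimes\cdots\otimes e_i\in(\mathbb{C}^r)^{\otimes k}$. $s\unrhd t$ means $t$ lies in the Euclidean closure of $\{(A_1\otimes\cdots\otimes A_k)s:A_i:V_i\to W_i\text{ linear}\}$. *)

(* Defs.v *)
From HB Require Import structures.
From mathcomp Require Import all_boot all_order all_algebra spectral.
From mathcomp Require Import complex.
From mathcomp Require Import all_classical all_reals ereal exp.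

Set Implicit Arguments.
Unset Strict Implicit.
Unset Printing Implicit Defensive.

Import Order.TTheory GRing.Theory Num.Theory.
Local Open Scope ring_scope.

Section Tensors.
Variables (R : realType) (k : nat).
Local Notation C := (complex R).

(* A family I : 'I_k -> finType stands for the spaces V_j = C^(I j), each with
   its standard basis (indexed by I j) and its standard inner product.  The
   product basis of the tensor product of the V_j is indexed by idx I, and a
   tensor is given by its coordinates in it. *)
Definition idx (I : 'I_k -> finType) : finType :=
  {dffun forall j : 'I_k, I j}.

Definition tensor (I : 'I_k -> finType) : Type := {ffun idx I -> C}.

(* The basis of V_S = \bigotimes_(j in S) V_j. *)
Definition sidx (I : 'I_k -> finType) (S : {set 'I_k}) : finType :=
  {dffun forall j : {j : 'I_k | j \in S}, I (val j)}.

Definition restr (I : 'I_k -> finType) (S : {set 'I_k}) (x : idx I) :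
  sidx I S := [ffun j => x (val j)].

(* Linear maps C^T -> C^U between coordinate spaces over finite types. *)
Definition lin (T U : finType) : Type := 'M[C]_(#|U|, #|T|).

Definition act (I J : 'I_k -> finType) (A : forall j, lin (I j) (J j))
    (s : tensor I) : tensor J :=
  [ffun y : idx J => \sum_(x : idx I)
     (\prod_j A j (enum_rank (y j)) (enum_rank (x j))) * s x].

Definition dsum (I J : 'I_k -> finType) (s : tensor I) (t : tensor J) :
    tensor (fun j => (I j + J j)%type : finType) :=
  [ffun z : idx (fun j => (I j + J j)%type : finType) =>
     \sum_(x : idx I | [forall j, z j == inl (x j)]) s x
     + \sum_(y : idx J | [forall j, z j == inr (y j)]) t y].

Definition tprod (I J : 'I_k -> finType) (s : tensor I) (t : tensor J) :
    tensor (fun j => (I j * J j)%type : finType) :=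
  [ffun z : idx (fun j => (I j * J j)%type : finType) =>
     s [ffun j => (z j).1] * t [ffun j => (z j).2]].

Definition unit_tensor (r : nat) : tensor (fun _ => 'I_r : finType) :=
  [ffun x : idx (fun _ => 'I_r : finType) =>
     \sum_(i < r) \prod_j (x j == i)%:R].

Definition normsq (I : 'I_k -> finType) (s : tensor I) : C :=
  \sum_(x : idx I) s x * (s x)^*.

Definition norm2 (I : 'I_k -> finType) (s : tensor I) : R :=
  Num.sqrt (complex.Re (normsq s)).

Definition degenerates (I J : 'I_k -> finType) (s : tensor I) (t : tensor J) :
    Prop :=
  forall e : R, 0 < e ->
  exists A : forall j, lin (I j) (J j), norm2 [ffun y => act A s y - t y] < e.

Definition density (I : 'I_k -> finType) (s : tensor I) (x y : idx I) : C :=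
  s x * (s y)^* / normsq s.

(* The partial trace over the complement of S: the linear map sending
   |x><y| to |x_S><y_S| if x and y agree outside S, and to 0 otherwise. *)
Definition ptrace (I : 'I_k -> finType) (S : {set 'I_k})
    (rho : idx I -> idx I -> C) : 'M[C]_#|sidx I S| :=
  \matrix_(a, b)
    \sum_(x : idx I | restr S x == enum_val a)
    \sum_(y : idx I | (restr S y == enum_val b)
                      && (restr (~: S) x == restr (~: S) y)) rho x y.

Definition log2 (x : R) : R := ln x / ln 2.

(* Functional calculus, for Hermitian A.  As ln 0 = 0 in the library, the
   convention 0 log 0 = 0 is respected in entropy. *)
Definition mxlog2 (n : nat) (A : 'M[C]_n) : 'M[C]_n :=
  invmx (spectralmx A)
  *m diag_mx (map_mx (fun z : C => (log2 (complex.Re z))%:C%C)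
                     (spectral_diag A))
  *m spectralmx A.

(* The trace is real for Hermitian A. *)
Definition entropy (n : nat) (A : 'M[C]_n) : R :=
  - complex.Re (\tr (A *m mxlog2 A)).

Definition is_bipartition (P : {set {set 'I_k}}) : bool :=
  [exists S : {set 'I_k},
     [&& S != finset.set0, ~: S != finset.set0 & P == [set S; ~: S]%SET]].

Definition bipartition : finType := {P : {set {set 'I_k}} | is_bipartition P}.

(* An arbitrary side of the unordered pair; every use below is symmetric in
   the two sides. *)
Definition side (b : bipartition) : {set 'I_k} :=
  odflt finset.set0 [pick S in val b].

Definition is_dist (theta : bipartition -> R) : Prop :=
  (forall b, 0 <= theta b) /\ \sum_b theta b = 1.

Definition Htheta (theta : bipartition -> R) (I : 'I_k -> finType)
    (s : tensor I) : R :=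
  \sum_b theta b * entropy (ptrace (side b) (density s)).

Definition Etheta (theta : bipartition -> R) (I : 'I_k -> finType)
    (t : tensor I) : \bar R :=
  if t == [ffun=> 0] then -oo%E else
  ereal_sup [set (Htheta theta (act A t))%:E |
    A in [set A : forall j, lin (I j) (I j) | forall j, A j \in unitmx]]%classic.

Definition exp2e (x : \bar R) : \bar R :=
  match x with
  | EFin r => (2 `^ r)%:E
  | +oo%E => +oo%E
  | -oo%E => 0%E
  end.

Definition Ftheta (theta : bipartition -> R) (I : 'I_k -> finType)
    (t : tensor I) : \bar R := exp2e (Etheta theta t).

Definition sdim (I : 'I_k -> finType) (S : {set 'I_k}) : nat := #|sidx I S|.

End Tensors.

Arguments unit_tensor R k r : clear implicits.

(* Main.v *)
Require Import Defs.
From HB Require Import structures.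
From mathcomp Require Import all_boot all_order all_algebra spectral sesquilinear.
From mathcomp Require Import ring lra complex.
From mathcomp Require Import all_classical all_reals ereal topology normedtype.
From mathcomp Require Import sequences derive realfun exp.

(** The von Neumann entropy of a density matrix is determined by its power
    traces: on [0, 1], -x ln x is uniformly approximated from below, with error
    at most 1/(M+1), by the polynomials x sum_(1 <= m <= M) (1 - x)^m / m, which
    vanish at 0.  For the marginal on V_S of a tensor with flattening N, the
    power traces are those of N N^*.  This reduces everything to matrix
    identities: power traces add under direct sums, multiply under tensor
    products, and for N replaced by X N Y they only depend on X^* X and Y Y^*.
    For the direct sum, the two summands are scaled to have squared norms
    2^H(s) and 2^H(t), the weights that maximise the entropy of the mixture.
    For degenerations, the polynomial approximation makes the entropy lower
    semicontinuous; a rectangular A_j may be replaced by a square matrix with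
    the same A_j^* A_j, which is a limit of invertible ones. *)

Set Implicit Arguments.
Unset Strict Implicit.
Unset Printing Implicit Defensive.

Import Order.TTheory GRing.Theory Num.Theory.
Import numFieldNormedType.Exports.
Local Open Scope ring_scope.

(** * Polynomial approximation of -x ln x *)

Section Eta.
Variable R : realType.
Implicit Types x y : R.

(** Spectra are awkward to compare directly: the eigenvalues come in an unspecified order, and the
    matrices on the two sides of an identity often have different sizes, so the spectra differ by
    zeros. Traces of positive powers see neither order nor zeros, and they are polynomials in the
    entries and their conjugates, so the same approximating polynomials yield exact equalities of
    entropies as well as limits. Nonemptiness of both sides of a bipartition enters through
    orthogonality: $V_S$ and $W_S$ have orthogonal images in $\bigotimes_{j\in S}(V_j\oplus W_j)$
    only if $S$ is nonempty. In a direct sum the mixing weight is a ratio of squared norms, hence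
    the same for every bipartition, and the mixing entropy survives averaging over $\theta$
    unchanged. For $\langle r\rangle$ the upper bound holds on the whole orbit because every
    flattening factors through $\mathbb{C}^r$. *)

Definition shannon x : R := - (x * ln x).

Definition lnpoly (M : nat) : {poly R} :=
  \sum_(m < M) (m.+1%:R^-1) *: (1 - 'X) ^+ m.+1.

Definition shannonpoly (M : nat) : {poly R} := 'X * lnpoly M.

Lemma deriv_1subX : (1 - 'X : {poly R})^`() = -1.
Proof. by rewrite derivB derivX -[1 in LHS]/(1%:P) derivC sub0r. Qed.

Lemma lnpolyE M x :
  (lnpoly M).[x] = \sum_(m < M) (m.+1%:R^-1) * (1 - x) ^+ m.+1.
Proof.
rewrite /lnpoly horner_sum; apply: eq_bigr => m _.
by rewrite hornerZ horner_exp !hornerE.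
Qed.

Lemma deriv_lnpoly M : (lnpoly M)^`() = - \sum_(m < M) (1 - 'X) ^+ m.
Proof.
rewrite /lnpoly raddf_sum /= -sumrN; apply: eq_bigr => m _.
rewrite derivZ deriv_exp deriv_1subX mulN1r /= mulNrn scalerN.
rewrite -[(_ ^+ _) *+ _]scaler_nat scalerA.
by rewrite mulVf ?pnatr_eq0 // scale1r.
Qed.

(** The derivative is a geometric sum in [1 - x]; multiplying by [x] telescopes it without a
    division. *)
Lemma deriv_lnpolyE M x : x * ((lnpoly M)^`()).[x] = (1 - x) ^+ M - 1.
Proof.
have := subrX1 (1 - x) M; rewrite deriv_lnpoly hornerN horner_sum => ->.
rewrite addrAC subrr sub0r mulrN mulNr; congr (- (_ * _)).
by apply: eq_bigr => m _; rewrite horner_exp !hornerE.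
Qed.

Lemma is_derive_horner (p : {poly R}) x : is_derive x 1 (horner p) (p^`()).[x].
Proof.
split; first exact: derivable_horner.
by rewrite -derive1E derivE.
Qed.

Lemma shannon0 : shannon 0 = 0.
Proof. by rewrite /shannon mul0r oppr0. Qed.

Lemma shannonM x y : 0 <= x -> 0 <= y -> shannon (x * y) = x * shannon y + y * shannon x.
Proof.
rewrite !le_eqVlt => /predU1P[<- _|x0 /predU1P[<-|y0]].
- by rewrite !mul0r shannon0 mulr0 addr0.
- by rewrite mulr0 shannon0 mulr0 mul0r addr0.
by rewrite /shannon lnM ?posrE //; ring.
Qed.

Lemma shannonpoly_bound M x : 0 <= x <= 1 ->
  (shannonpoly M).[x] <= shannon x <= (shannonpoly M).[x] + M.+1%:R^-1.
Proof.
case/andP => x0 x1; rewrite /shannonpoly hornerM hornerX.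
move: x0; rewrite le_eqVlt => /predU1P[<-|x0].
  by rewrite shannon0 mul0r lexx add0r invr_ge0 ler0n.
(* Both bounds vanish at 1, and -ln y - lnpoly M y has derivative
   -(1 - y)^M / y, which lies between -(1 - y)^M / x and 0 on [x, 1]. *)
pose f (c y : R) : R := - ln y - (lnpoly M).[y] - c * ((1 - y) ^+ M.+1).
have df (c y : R) : 0 < y ->
   is_derive y 1 (f c) (- ((1 - y) ^+ M / y) + c * (M.+1%:R * (1 - y) ^+ M)).
  move=> y0; pose q : {poly R} := (lnpoly M) + c *: (1 - 'X) ^+ M.+1.
  have -> : f c = (fun z => - ln z - q.[z]).
    apply: funext => z; rewrite /f /q !hornerE; ring.
  have := is_deriveB (is_deriveN (is_derive1_ln y0)) (is_derive_horner q y).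
  congr (is_derive _ _ _ _).
  rewrite /q derivD hornerD derivZ hornerZ deriv_exp deriv_1subX mulN1r /=.
  have yn0 : y != 0 by rewrite gt_eqF.
  have -> : ((lnpoly M)^`()).[y] = ((1 - y) ^+ M - 1) / y.
    by rewrite -deriv_lnpolyE mulrAC mulfV ?mul1r.
  rewrite mulNrn hornerN hornerMn horner_exp -mulr_natl.
  have -> : (1 - 'X).[y] = 1 - y by rewrite !hornerE.
  by field.
have ball c : exists2 z, x <= z <= 1 &
    f c 1 - f c x = (- ((1 - z) ^+ M / z) + c * (M.+1%:R * (1 - z) ^+ M)) * (1 - x).
  have := @MVT_segment R (f c)
     (fun z => - ((1 - z) ^+ M / z) + c * (M.+1%:R * (1 - z) ^+ M)) x 1 x1.
  case.
  - by move=> z; rewrite in_itv /= => /andP[xz _]; apply: df; apply: lt_trans xz.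
  - apply: derivable_within_continuous => z; rewrite in_itv /= => /andP[xz _].
    by have [] := df c z (lt_le_trans x0 xz).
  - by move=> z; rewrite in_itv /= => zz e; exists z.
have f1 c : f c 1 = 0.
  rewrite /f ln1 lnpolyE big1 => [|m _]; rewrite ?subrr ?exprS ?mul0r ?mulr0 //.
  by rewrite !subr0 oppr0.
have etax c : shannon x = x * (lnpoly M).[x] + x * c * (1 - x) ^+ M.+1 + x * f c x.
  by rewrite /shannon /f; ring.
have p0 z : z <= 1 -> 0 <= (1 - z) ^+ M by move=> z1; rewrite exprn_ge0 // subr_ge0.
apply/andP; split.
  have [z /andP[xz z1]] := ball 0; rewrite f1 (etax 0) !(mulr0, mul0r, addr0).
  rewrite sub0r => /eqP; rewrite eqr_oppLR => /eqP ->.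
  rewrite lerDl mulr_ge0 ?(ltW x0) //.
  rewrite mulNr opprK mulr_ge0 ?subr_ge0 // divr_ge0 ?p0 //.
  exact: le_trans (ltW x0) xz.
(* The lower bound was the case c = 0. This [c] makes the derivative of [f c] at [z] equal to (1 -
   z)^M (1/x - 1/z), which is nonnegative for z >= x, while the correction [x * c] is exactly
   1/(M+1). *)
pose c := (M.+1%:R * x)^-1 : R.
have [z /andP[xz z1]] := ball c; rewrite f1 (etax c) sub0r => e.
have Mn0 : M.+1%:R != 0 :> R by rewrite pnatr_eq0.
have xn0 : x != 0 by rewrite gt_eqF.
have z0 : 0 < z := lt_le_trans x0 xz.
have fx : f c x <= 0.
  rewrite -oppr_ge0 e mulr_ge0 ?subr_ge0 //.
  have -> : c * (M.+1%:R * (1 - z) ^+ M) = (1 - z) ^+ M / x.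
    by rewrite /c invfM mulrACA mulVf // mul1r mulrC.
  rewrite addrC -mulrBr mulr_ge0 ?p0 // subr_ge0 lef_pV2 ?posrE //.
have -> : x * c = M.+1%:R^-1 by rewrite /c invfM mulrCA mulfV // mulr1.
rewrite -addrA lerD2l -[leRHS]addr0 lerD ?mulr_ge0_le0 ?(ltW x0) //.
rewrite ler_piMr ?invr_ge0 ?ler0n // exprn_ile1 ?subr_ge0 //.
by rewrite lerBlDr lerDl ltW.
Qed.

Lemma sum_horner_powers (T : finType) (l : T -> R) (p : {poly R}) :
  \sum_i p.[l i] = \sum_(m < size p) p`_m * \sum_i l i ^+ m.
Proof.
under eq_bigr do rewrite horner_coef.
by rewrite exchange_big /=; apply: eq_bigr => m _; rewrite mulr_sumr.
Qed.

(** Removes the zeroth power sum, which merely counts the index set and would distinguish spectra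
    differing by zeros. *)
Lemma shannonpoly0 M : (shannonpoly M)`_0 = 0.
Proof. by rewrite /shannonpoly mulrC coefMX. Qed.

Lemma small_eq (a b c : R) : (forall M : nat, `|a - b| <= c / M.+1%:R) -> a = b.
Proof.
move=> h; apply/eqP; rewrite -subr_eq0 -normr_le0 leNgt; apply/negP => ab0.
have c0 : 0 <= c.
  have := h 0; rewrite divr1; apply: le_trans; exact: ltW.
have := h (Num.bound (c / `|a - b|)).
have := archi_boundP (divr_ge0 c0 (ltW ab0)).
rewrite ltr_pdivrMr // => h1; rewrite ler_pdivlMr ?ltr0n // mulrC => h2.
have : c < c.
  apply: lt_le_trans h1 (le_trans _ h2); rewrite ler_pM2r //.
  by rewrite ler_nat.
by rewrite ltxx.
Qed.

Lemma sum_shannonpoly_bound (T : finType) (l : T -> R) M :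
  (forall i, 0 <= l i <= 1) ->
  \sum_i (shannonpoly M).[l i] <= \sum_i shannon (l i)
    <= \sum_i (shannonpoly M).[l i] + #|T|%:R / M.+1%:R.
Proof.
move=> hl; apply/andP; split.
  by apply: ler_sum => i _; case/andP: (shannonpoly_bound M (hl i)).
rewrite mulr_natl -sumr_const -big_split /=.
by apply: ler_sum => i _; case/andP: (shannonpoly_bound M (hl i)).
Qed.

(** Both sums are approximated by the same combination of power sums, so the values themselves never
    have to be matched up; positive exponents allow [T] and [U] to have different cardinalities. *)
Lemma sum_shannon_powers (T U : finType) (l : T -> R) (u : U -> R) :
  (forall i, 0 <= l i <= 1) -> (forall i, 0 <= u i <= 1) ->
  (forall m, \sum_i l i ^+ m.+1 = \sum_i u i ^+ m.+1) ->
  \sum_i shannon (l i) = \sum_i shannon (u i).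
Proof.
move=> hl hu e; apply: (@small_eq _ _ (#|T|%:R + #|U|%:R)) => M.
have : \sum_i (shannonpoly M).[l i] = \sum_i (shannonpoly M).[u i].
  rewrite !sum_horner_powers; apply: eq_bigr => -[[|m] hm] _ /=.
    by rewrite shannonpoly0 !mul0r.
  by rewrite e.
have /andP[] := sum_shannonpoly_bound M hl; have /andP[] := sum_shannonpoly_bound M hu.
rewrite mulrDl ler_norml.
have : 0 <= #|T|%:R / M.+1%:R :> R by rewrite divr_ge0 ?ler0n.
have : 0 <= #|U|%:R / M.+1%:R :> R by rewrite divr_ge0 ?ler0n.
by move: (_ / _) (_ / _) => *; lra.
Qed.

(** Gibbs' inequality against the uniform distribution: ln y <= y - 1 at y = 1/(|T| l_i) bounds each
    term of the difference by 1/|T| - l_i, and these bounds sum to 0. *)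
Lemma sum_shannon_le (T : finType) (l : T -> R) :
  (forall i, 0 <= l i) -> \sum_i l i = 1 -> \sum_i shannon (l i) <= ln #|T|%:R.
Proof.
move=> l0 l1.
have T0 : 0 < #|T|%:R :> R.
  rewrite ltr0n; apply/card_gt0P; case: (pickP T) => [i _|T0]; first by exists i.
  by move: l1; rewrite big_pred0 // => /eqP; rewrite eq_sym oner_eq0.
have -> : ln #|T|%:R = \sum_i l i * ln #|T|%:R by rewrite -mulr_suml l1 mul1r.
rewrite -subr_le0 -sumrB.
rewrite [leRHS](_ : 0 = \sum_(i : T) (#|T|%:R^-1 - l i)); last first.
  by rewrite sumrB l1 sumr_const -[_ *+ _]mulr_natl mulfV ?subrr // gt_eqF.
apply: ler_sum => i _.
have := l0 i; rewrite le_eqVlt => /predU1P[<-|li0].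
  by rewrite shannon0 mul0r !subr0 invr_ge0 ltW.
have h : ln (#|T|%:R * l i)^-1 <= (#|T|%:R * l i)^-1 - 1.
  rewrite -[X in ln X](subrK 1) addrC; apply: le_ln1Dx.
  by rewrite ltrBrDr addNr invr_gt0 mulr_gt0.
have -> : shannon (l i) - l i * ln #|T|%:R = l i * ln (#|T|%:R * l i)^-1.
  by rewrite lnV ?lnM ?posrE ?mulr_gt0 // /shannon; ring.
apply: le_trans (ler_wpM2l (l0 i) h) _.
rewrite mulrBr mulr1 invfM mulrCA mulfV ?mulr1 //; exact: lt0r_neq0.
Qed.

End Eta.

(** * Power traces and entropy *)

Section Spectrum.
Variable R : realType.
Local Notation C := (complex R).
Local Open Scope sesquilinear_scope.

Lemma adjmxE m n (A : 'M[C]_(m, n)) i j : (A ^t* ) i j = (A j i)^*.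
Proof. by rewrite !mxE. Qed.

Lemma adjmxM m n p (A : 'M[C]_(m, n)) (B : 'M[C]_(n, p)) :
  (A *m B)^t* = B^t* *m A^t*.
Proof. by rewrite trmx_mul map_mxM. Qed.

Lemma adjmxZ m n (c : C) (A : 'M[C]_(m, n)) : (c *: A)^t* = c^* *: A^t*.
Proof. by apply/matrixP => i j; rewrite !mxE rmorphM. Qed.

Lemma mxpowS n (A : 'M[C]_n) m : A ^+ m.+1 = A *m A ^+ m.
Proof. exact: exprS. Qed.

(** Cyclicity of the trace. The exponent is positive because the zeroth powers have traces [n] and
    [p]. *)
Lemma mxtrace_mul_powC (n p m : nat) (X : 'M[C]_(n, p)) (Y : 'M[C]_(p, n)) :
  \tr ((X *m Y) ^+ m.+1) = \tr ((Y *m X) ^+ m.+1).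
Proof.
have e q : (X *m Y) ^+ q.+1 = X *m ((Y *m X) ^+ q *m Y).
  elim: q => [|q IH]; first by rewrite expr1 expr0 mul1mx.
  by rewrite mxpowS IH mxpowS -!mulmxA.
by rewrite e mxtrace_mulC -mulmxA mulmxE -exprSr.
Qed.

Lemma gram_spectral n p (M : 'M[C]_(n, p)) :
  let A := M *m M^t* in
  exists l : 'I_n -> R, (forall i, 0 <= l i) /\
    [/\ spectral_diag A = \row_i (l i)%:C%C
      & A = invmx (spectralmx A) *m diag_mx (spectral_diag A) *m spectralmx A].
Proof.
move=> A; have hA : A \is normalmx.
  by apply/normalmxP; rewrite /A adjmxM trmxCK.
have e := orthomx_spectralP hA.
set U := spectralmx A in e *; set D := spectral_diag A in e *.
have uU : U \in unitmx by exact: spectral_unit.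
have dD : diag_mx D = (U *m M) *m (U *m M)^t*.
  rewrite adjmxM -invmx_unitary ?spectral_unitarymx // -/U.
  by rewrite !mulmxA -(mulmxA U) -/A e !mulmxA (mulmxV uU) mul1mx (mulmxK uU).
(* In the order of [C], [0 <= z] also says that [z] is real, so this one claim gives both realness
   and sign of the eigenvalues. *)
have D0 i : 0 <= D 0 i.
  have -> : D 0 i = diag_mx D i i by rewrite mxE eqxx mulr1n.
  rewrite dD mxE; apply: sumr_ge0 => j _.
  by rewrite adjmxE mul_conjC_ge0.
exists (fun i => complex.Re (D 0 i)); split.
  by move=> i; have := D0 i; rewrite lecE /= => /andP[].
split=> //; apply/rowP => i; rewrite mxE RRe_real // ger0_real //.
Qed.

Lemma diag_conj_pow n (A U : 'M[C]_n) (d : 'rV[C]_n) m :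
  U \in unitmx -> A = invmx U *m diag_mx d *m U ->
  A ^+ m = invmx U *m diag_mx (\row_i (d 0 i) ^+ m) *m U.
Proof.
move=> uU e; elim: m => [|m IH].
  have -> : diag_mx (\row_i (d 0 i) ^+ 0) = 1%:M :> 'M[C]_n.
    by apply/matrixP => i j; rewrite !mxE expr0.
  by rewrite mulmx1 mulVmx.
rewrite mxpowS IH [X in X *m _]e !mulmxA (mulmxK uU); congr (_ *m _).
rewrite -!mulmxA; congr (_ *m _).
apply/matrixP => i j; rewrite mul_diag_mx !mxE.
by case: eqVneq => [->|_]; rewrite ?mulr0 // !mulr1n exprS.
Qed.

Lemma gram_spectrum n p (M : 'M[C]_(n, p)) :
  exists l : 'I_n -> R, [/\ forall i, 0 <= l i,
    forall m, \tr ((M *m M^t* ) ^+ m) = (\sum_i l i ^+ m)%:C%C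
  & entropy (M *m M^t* ) = (\sum_i shannon (l i)) / ln 2].
Proof.
have [l [l0 [eD e]]] := gram_spectral M; exists l; split=> //.
  move=> m; set A := M *m _ in eD e *; set U := spectralmx A in e.
  have uU : U \in unitmx by exact: spectral_unit.
  rewrite (diag_conj_pow m uU e).
  rewrite mxtrace_mulC mulmxA (mulmxV uU) mul1mx mxtrace_diag rmorph_sum /=.
  by apply: eq_bigr => i _; rewrite mxE eD mxE rmorphXn.
rewrite /entropy /mxlog2 [X in \tr (X *m _)]e.
set A := M *m _ in eD e *; set U := spectralmx A in e *.
have uU : U \in unitmx by exact: spectral_unit.
rewrite !mulmxA (mulmxK uU) mxtrace_mulC !mulmxA (mulmxV uU) mul1mx.
rewrite mulmx_diag mxtrace_diag eD.
have -> : \sum_i (\row_j ((\row_i0 (l i0)%:C%C) 0 j * (map_mx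
   (fun z : C => (log2 (complex.Re z))%:C%C) (\row_i0 (l i0)%:C%C)) 0 j)) 0 i
   = (\sum_i l i * log2 (l i))%:C%C.
  by rewrite rmorph_sum; apply: eq_bigr => i _; rewrite !mxE -rmorphM.
rewrite /= -sumrN mulr_suml; apply: eq_bigr => i _.
by rewrite /shannon /log2 mulNr mulrA.
Qed.

Definition trpow n p (M : 'M[C]_(n, p)) m : C := \tr ((M *m M^t* ) ^+ m).

Lemma trpow_real n p (M : 'M[C]_(n, p)) m : trpow M m = (complex.Re (trpow M m))%:C%C.
Proof. by have [l [_ h _]] := gram_spectrum M; rewrite /trpow h. Qed.

Lemma trpow1_ge0 n p (M : 'M[C]_(n, p)) : 0 <= complex.Re (trpow M 1).
Proof.
have [l [l0 h _]] := gram_spectrum M; rewrite /trpow h /=.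
by apply: sumr_ge0 => i _; rewrite expr1.
Qed.

Lemma trpow1E n p (M : 'M[C]_(n, p)) : trpow M 1 = \sum_i \sum_j M i j * (M i j)^*.
Proof.
rewrite /trpow expr1; apply: eq_bigr => i _; rewrite mxE.
by apply: eq_bigr => j _; rewrite adjmxE.
Qed.

(** The m-th power trace of [mxden M] when [M] is nonzero. Keeping the trace and the normalisation
    apart lets additive and multiplicative identities be applied to the unnormalised [trpow]. *)
Definition nmom n p (M : 'M[C]_(n, p)) m : R :=
  complex.Re (trpow M m) / complex.Re (trpow M 1) ^+ m.

Definition mxden n p (M : 'M[C]_(n, p)) : 'M[C]_n :=
  (trpow M 1)^-1 *: (M *m M^t* ).

Lemma mxpowZ n (A : 'M[C]_n) (c : C) m : (c *: A) ^+ m = c ^+ m *: A ^+ m.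
Proof.
elim: m => [|m IH]; first by rewrite !expr0 scale1r.
by rewrite !mxpowS IH -scalemxAl -scalemxAr scalerA -exprS.
Qed.

Lemma mxden_spectrum n p (M : 'M[C]_(n, p)) : trpow M 1 != 0 ->
  exists l : 'I_n -> R, [/\ forall i, 0 <= l i <= 1, \sum_i l i = 1,
    forall m, nmom M m = \sum_i l i ^+ m
  & entropy (mxden M) = (\sum_i shannon (l i)) / ln 2].
Proof.
move=> N0; pose N := complex.Re (trpow M 1).
have NE : trpow M 1 = N%:C%C by rewrite trpow_real.
have Np : 0 < N.
  rewrite lt_def trpow1_ge0 andbT; apply: contraNneq N0.
  by rewrite NE => ->.
(* Scaling [M] by the inverse square root of its squared norm makes [mxden M] itself a Gram matrix,
   to which [gram_spectrum] applies. *)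
pose c := (Num.sqrt N)^-1.
have cc : c * c = N^-1 by rewrite -invfM -expr2 sqr_sqrtr // ltW.
have e : mxden M = (c%:C%C *: M) *m (c%:C%C *: M)^t*.
  have cr : (c%:C%C : C)^* = c%:C%C by apply: conj_Creal; apply/complex_realP; exists c.
  rewrite adjmxZ cr -scalemxAl -scalemxAr scalerA -rmorphM cc /mxden NE.
  by rewrite fmorphV.
have [l [l0 h he]] := gram_spectrum (c%:C%C *: M).
rewrite -e in h he.
have hm m : nmom M m = \sum_i l i ^+ m.
  apply: complexI; rewrite -h /mxden mxpowZ mxtraceZ -/(trpow M m) NE.
  rewrite /nmom mulrC rmorphM fmorphV /= -trpow_real rmorphXn /=.
  by rewrite -/N exprVn.
have l1 : \sum_i l i = 1.
  have := hm 1%N; under eq_bigr do rewrite expr1.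
  move=> <-; rewrite /nmom expr1 -/N divff //; exact: lt0r_neq0.
exists l; split=> // i; rewrite l0 /= -l1 (bigD1 i) //= lerDl.
exact: sumr_ge0.
Qed.

(** Allows an entropy to be computed by exhibiting any family with the right power sums, over any
    finite type, instead of diagonalising. *)
Lemma entropy_mxden n p (M : 'M[C]_(n, p)) (T : finType) (u : T -> R) :
  trpow M 1 != 0 -> (forall i, 0 <= u i <= 1) ->
  (forall m, nmom M m.+1 = \sum_i u i ^+ m.+1) ->
  entropy (mxden M) = (\sum_i shannon (u i)) / ln 2.
Proof.
move=> N0 hu hm; have [l [hl l1 hl' ->]] := mxden_spectrum N0.
by congr (_ / _); apply: sum_shannon_powers => // m; rewrite -hm hl'.
Qed.

Lemma eq_entropy_nmom n p n' p' (M : 'M[C]_(n, p)) (M' : 'M[C]_(n', p')) :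
  trpow M 1 != 0 -> trpow M' 1 != 0 ->
  (forall m, nmom M m.+1 = nmom M' m.+1) -> entropy (mxden M) = entropy (mxden M').
Proof.
move=> N0 N0' hm; have [l [hl l1 hl' ->]] := mxden_spectrum N0'.
by apply: entropy_mxden => // m; rewrite hm hl'.
Qed.

Lemma ln2_gt0 : 0 < ln 2 :> R.
Proof. by rewrite ln_gt0 // ltr1n. Qed.

Lemma entropy_le_dim n p (M : 'M[C]_(n, p)) : trpow M 1 != 0 ->
  entropy (mxden M) <= log2 n%:R.
Proof.
move=> N0; have [l [hl l1 _ ->]] := mxden_spectrum N0.
rewrite /log2 ler_pM2r ?invr_gt0 ?ln2_gt0 // -[n in n%:R]card_ord.
by apply: sum_shannon_le => // i; case/andP: (hl i).
Qed.

Definition mxent_approx n p (M : 'M[C]_(n, p)) K : R :=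
  \sum_(m < size (shannonpoly R K)) (shannonpoly R K)`_m * nmom M m.

Lemma mxent_approx_bound n p (M : 'M[C]_(n, p)) K : trpow M 1 != 0 ->
  mxent_approx M K <= entropy (mxden M) * ln 2 <= mxent_approx M K + n%:R / K.+1%:R.
Proof.
move=> N0; have [l [hl l1 hl' ->]] := mxden_spectrum N0.
rewrite divfK ?gt_eqF ?ln2_gt0 //.
have := sum_shannonpoly_bound K hl; rewrite sum_horner_powers card_ord.
by rewrite /mxent_approx; under eq_bigr do rewrite -hl'.
Qed.

(* [B + e U] is [D + e] times the unitary [U] that diagonalises [A^* A], where
   [D] is the diagonal matrix of the singular values of [A]. *)
Lemma gram_square_root n p (A : 'M[C]_(p, n)) : exists B U : 'M[C]_n,
  B^t* *m B = A^t* *m A /\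
  forall e : R, 0 < e -> B + e%:C%C *: U \in unitmx.
Proof.
have [l [l0 [eD e]]] := gram_spectral (A^t* ).
move: eD e; rewrite trmxCK; set G := A^t* *m A.
set U := spectralmx G => eD e.
have uU : U \in unitmx by exact: spectral_unit.
pose D : 'rV[C]_n := \row_i (Num.sqrt (l i))%:C%C.
exists (diag_mx D *m U), U; split.
  rewrite adjmxM -invmx_unitary ?spectral_unitarymx // -/U [RHS]e.
  rewrite !mulmxA; congr (_ *m _); rewrite -!mulmxA; congr (_ *m _).
  rewrite eD; apply/matrixP => i j; rewrite mul_mx_diag !mxE.
  have cr (c : R) : (c%:C%C : C)^* = c%:C%C.
    by apply: conj_Creal; apply/complex_realP; exists c.
  case: (eqVneq j i) => [->|ji].
    by rewrite !mulr1n cr -rmorphM -expr2 sqr_sqrtr.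
  by rewrite !mulr0n rmorph0 mul0r.
move=> x x0.
have -> : diag_mx D *m U + x%:C%C *: U =
    diag_mx (\row_i (Num.sqrt (l i) + x)%:C%C) *m U.
  rewrite -mul_scalar_mx -mulmxDl; congr (_ *m _).
  apply/matrixP => i j; rewrite !mxE.
  by case: eqP => _; rewrite ?addr0 // !mulr1n rmorphD.
rewrite unitmx_mul uU andbT unitmxE det_diag unitfE.
apply/prodf_neq0 => i _; rewrite mxE.
have : Num.sqrt (l i) + x != 0 by rewrite gt_eqF // ltr_wpDl ?sqrtr_ge0.
by apply: contraNneq => /complexI ->.
Qed.

End Spectrum.

(** * Lower semicontinuity of the entropy *)

Section ComplexSequences.
Variable R : realType.
Local Notation C := (complex R).
Local Open Scope classical_set_scope.
Local Open Scope sesquilinear_scope.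

Lemma Re_add (x y : C) : complex.Re (x + y) = complex.Re x + complex.Re y.
Proof. by case: x y => [? ?] []. Qed.

Lemma Im_add (x y : C) : complex.Im (x + y) = complex.Im x + complex.Im y.
Proof. by case: x y => [? ?] []. Qed.

Lemma Re_mul (x y : C) : complex.Re (x * y) =
  complex.Re x * complex.Re y - complex.Im x * complex.Im y.
Proof. by case: x y => [? ?] []. Qed.

Lemma Im_mul (x y : C) : complex.Im (x * y) =
  complex.Re x * complex.Im y + complex.Im x * complex.Re y.
Proof. by case: x y => [? ?] []. Qed.

Lemma Re_conjE (x : C) : complex.Re x^* = complex.Re x.
Proof. by case: x. Qed.

Lemma Im_conjE (x : C) : complex.Im x^* = - complex.Im x.
Proof. by case: x. Qed.

Definition cvgC (u : nat -> C) (l : C) : Prop :=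
  (complex.Re (u n) @[n --> \oo] --> complex.Re l) /\
  (complex.Im (u n) @[n --> \oo] --> complex.Im l).

Lemma cvgC_cst (l : C) : cvgC (fun=> l) l.
Proof. by split; exact: cvg_cst. Qed.

Lemma cvgCD u v (l k : C) :
  cvgC u l -> cvgC v k -> cvgC (fun n => u n + v n) (l + k).
Proof.
move=> [u1 u2] [v1 v2]; split.
  by under eq_fun do rewrite Re_add; rewrite Re_add; exact: cvgD.
by under eq_fun do rewrite Im_add; rewrite Im_add; exact: cvgD.
Qed.

Lemma cvgCM u v (l k : C) :
  cvgC u l -> cvgC v k -> cvgC (fun n => u n * v n) (l * k).
Proof.
move=> [u1 u2] [v1 v2]; split.
  by under eq_fun do rewrite Re_mul; rewrite Re_mul; apply: cvgB; exact: cvgM.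
by under eq_fun do rewrite Im_mul; rewrite Im_mul; apply: cvgD; exact: cvgM.
Qed.

Lemma cvgC_conj u (l : C) : cvgC u l -> cvgC (fun n => (u n)^*) l^*.
Proof.
move=> [u1 u2]; split; first by under eq_fun do rewrite Re_conjE; rewrite Re_conjE.
by under eq_fun do rewrite Im_conjE; rewrite Im_conjE; exact: cvgN.
Qed.

Lemma cvgC_sum (I : Type) (r : seq I) (P : pred I) (F : I -> nat -> C) (l : I -> C) :
  (forall i, P i -> cvgC (F i) (l i)) ->
  cvgC (fun n => \sum_(i <- r | P i) F i n) (\sum_(i <- r | P i) l i).
Proof.
move=> h; elim: r => [|i r IH].
  by under eq_fun do rewrite big_nil; rewrite big_nil; exact: cvgC_cst.
under eq_fun do rewrite big_cons; rewrite big_cons.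
by case: ifP => // /h Pi; exact: cvgCD.
Qed.

Lemma cvgC_prod (I : Type) (r : seq I) (P : pred I) (F : I -> nat -> C) (l : I -> C) :
  (forall i, P i -> cvgC (F i) (l i)) ->
  cvgC (fun n => \prod_(i <- r | P i) F i n) (\prod_(i <- r | P i) l i).
Proof.
move=> h; elim: r => [|i r IH].
  by under eq_fun do rewrite big_nil; rewrite big_nil; exact: cvgC_cst.
under eq_fun do rewrite big_cons; rewrite big_cons.
by case: ifP => // /h Pi; exact: cvgCM.
Qed.

Definition cvgmx p q (A : nat -> 'M[C]_(p, q)) (B : 'M[C]_(p, q)) : Prop :=
  forall i j, cvgC (fun n => A n i j) (B i j).

Lemma cvgmxM p q r (A : nat -> 'M[C]_(p, q)) (A' : nat -> 'M[C]_(q, r)) B B' :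
  cvgmx A B -> cvgmx A' B' -> cvgmx (fun n => A n *m A' n) (B *m B').
Proof.
move=> h h' i j; under eq_fun do rewrite mxE; rewrite mxE.
by apply: cvgC_sum => k _; exact: cvgCM.
Qed.

Lemma cvgmx_adj p q (A : nat -> 'M[C]_(p, q)) B :
  cvgmx A B -> cvgmx (fun n => (A n)^t* ) (B^t* ).
Proof.
move=> h i j; under eq_fun do rewrite adjmxE; rewrite adjmxE.
exact: cvgC_conj.
Qed.

Lemma cvgmx_pow p (A : nat -> 'M[C]_p) B m :
  cvgmx A B -> cvgmx (fun n => A n ^+ m) (B ^+ m).
Proof.
move=> h; elim: m => [|m IH] i j.
  by under eq_fun do rewrite expr0; rewrite expr0; exact: cvgC_cst.
by under eq_fun do rewrite mxpowS; rewrite mxpowS; exact: cvgmxM.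
Qed.

Lemma cvg_trpow p q (A : nat -> 'M[C]_(p, q)) B m :
  cvgmx A B -> cvgC (fun n => trpow (A n) m) (trpow B m).
Proof.
move=> h; apply: cvgC_sum => i _; apply: cvgmx_pow; apply: cvgmxM => //.
exact: cvgmx_adj.
Qed.

Lemma cvg_nmom p q (A : nat -> 'M[C]_(p, q)) B m : trpow B 1 != 0 ->
  cvgmx A B -> nmom (A n) m @[n --> \oo] --> nmom B m.
Proof.
move=> B0 h; apply: cvgM; first by case: (cvg_trpow m h).
apply: cvgV.
  rewrite expf_neq0 //; apply: contraNneq B0 => B0.
  by rewrite trpow_real B0.
have : complex.Re (trpow (A n) 1) @[n --> \oo] --> complex.Re (trpow B 1).
  by case: (cvg_trpow 1 h).
move=> h'; apply: (cvg_comp (fun n => complex.Re (trpow (A n) 1))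
  (fun x : R => x ^+ m) h').
exact: exprn_continuous.
Qed.

Lemma cvg_mxent_approx p q (A : nat -> 'M[C]_(p, q)) B K : trpow B 1 != 0 ->
  cvgmx A B -> mxent_approx (A n) K @[n --> \oo] --> mxent_approx B K.
Proof.
move=> B0 h; rewrite /mxent_approx; elim: (index_enum _) => [|i r IH].
  by under eq_fun do rewrite big_nil; rewrite big_nil; exact: cvg_cst.
under eq_fun do rewrite big_cons; rewrite big_cons; apply: cvgD => //.
by apply: cvgM; [exact: cvg_cst|exact: cvg_nmom].
Qed.

Lemma near_trpow1_neq0 p q (A : nat -> 'M[C]_(p, q)) B : trpow B 1 != 0 ->
  cvgmx A B -> \forall n \near \oo, trpow (A n) 1 != 0.
Proof.
move=> B0 h; have [+ _] := cvg_trpow 1 h.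
have Bp : 0 < complex.Re (trpow B 1).
  rewrite lt_def trpow1_ge0 andbT; apply: contraNneq B0 => B0.
  by rewrite trpow_real B0.
move=> /cvgr_gt /(_ _ Bp); apply: filterS => n.
by apply: contraTneq => ->; rewrite ltxx.
Qed.

(** [mxent_approx] bounds the entropy of [A n] from below, is continuous, and at [B] falls short of
    the entropy (in nats) by at most p/(K+1). *)
Lemma entropy_lsc p q (A : nat -> 'M[C]_(p, q)) B : trpow B 1 != 0 ->
  cvgmx A B -> forall e : R, 0 < e ->
  \forall n \near \oo, entropy (mxden B) - e <= entropy (mxden (A n)).
Proof.
move=> B0 h e e0; have l20 := ln2_gt0 R.
(* Half of the slack pays for the approximation error at [B], the other half for the convergence of
   [mxent_approx]; the factor [ln 2] converts bits to nats. *)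
have [K hK] : exists K : nat, p%:R / K.+1%:R < e * ln 2 / 2.
  exists (Num.bound (p%:R / (e * ln 2 / 2))).
  have x0 : 0 < e * ln 2 / 2 by rewrite !mulr_gt0.
  rewrite ltr_pdivrMr // mulrC -ltr_pdivrMr //.
  apply: lt_le_trans (archi_boundP _) _; first by rewrite divr_ge0 ?ler0n ?ltW.
  by rewrite ler_nat.
have x0 : mxent_approx B K - e * ln 2 / 2 < mxent_approx B K.
  by rewrite ltrBlDr ltrDl !mulr_gt0.
have /cvgr_gt/(_ _ x0) := @cvg_mxent_approx _ _ _ _ K B0 h.
have /andP[_ b1] := mxent_approx_bound K B0.
move=> hn; near=> n.
have An0 : trpow (A n) 1 != 0 by near: n; exact: near_trpow1_neq0 B0 h.
have /andP[b2 _] := mxent_approx_bound K An0.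
have : mxent_approx B K - e * ln 2 / 2 < mxent_approx (A n) K by near: n.
move=> b3; rewrite -(ler_pM2r l20) mulrBl lerBlDr.
apply: le_trans b1 _; rewrite (splitr (e * ln 2)) addrA.
apply: lerD (ltW hK); apply: le_trans (lerD b2 (lexx _)).
by rewrite -lerBlDr ltW.
Unshelve. all: by end_near. Qed.

End ComplexSequences.

(** * Flattenings *)

(** Composing local maps sums over a middle index on each leg independently; this distributivity
    turns the product of those sums into one sum over index tuples. *)
Lemma big_distr_dffun (A : comPzSemiRingType) (K : finType) (T : K -> finType)
    (F : forall i, T i -> A) :
  \prod_i \sum_(x : T i) F i x = \sum_(f : {dffun forall i, T i}) \prod_i F i (f i).
Proof.
pose P i := [ffun x : T i => F i x].
transitivity (\prod_i \sum_(j in tagged_with T i) untag 0 (P i) j).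
  apply: eq_bigr => i _; rewrite -(big_tag (fun i => P i)).
  by apply: eq_bigr => x _; rewrite ffunE.
rewrite (bigA_distr_big_dep (fun i j => j \in tagged_with T i)).
rewrite -(big_fprod _ _ P).
rewrite (reindex (@fprod_of_dffun K T)) /=; last first.
  by apply: onW_bij; exact: fprod_of_dffun_bij.
apply: eq_bigr => f _; apply: eq_bigr => i _.
by rewrite ffunE fprodE.
Qed.

Section Flattening.
Variables (R : realType) (k : nat).
Local Notation C := (complex R).
Local Open Scope sesquilinear_scope.
Implicit Types (I J L : 'I_k -> finType) (S : {set 'I_k}).

Lemma in_compl S (j : 'I_k) : ~ (j \in S) -> j \in ~: S.
Proof. by rewrite inE => /negP. Qed.

(** Inverse of the pair of restrictions to [S] and its complement. Deciding membership through
    [decP] keeps the proof that the dependent index requires. *)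
Definition merge_idx I S (u : sidx I S) (v : sidx I (~: S)) : idx I :=
  [ffun j => match decP (@idP (j \in S)) with
             | left h => u (exist _ j h)
             | right h => v (exist _ j (in_compl h))
             end].

Lemma restr_merge I S (u : sidx I S) v : restr S (merge_idx u v) = u.
Proof.
apply/ffunP => -[j h]; rewrite !ffunE /=.
case: (decP _) => [h'|h']; last by case: (h').
by rewrite (bool_irrelevance h h').
Qed.

Lemma restrC_merge I S (u : sidx I S) v : restr (~: S) (merge_idx u v) = v.
Proof.
apply/ffunP => -[j h]; rewrite !ffunE /=.
case: (decP _) => [h'|h']; first by exfalso; move: h; rewrite inE h'.
by rewrite (bool_irrelevance h (in_compl h')).
Qed.

Lemma merge_restr I S (x : idx I) : merge_idx (restr S x) (restr (~: S) x) = x.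
Proof. by apply/ffunP => j; rewrite !ffunE; case: (decP _) => h; rewrite ffunE. Qed.

Lemma sum_merge (V : nmodType) I S (F : idx I -> V) :
  \sum_x F x = \sum_(u : sidx I S) \sum_(v : sidx I (~: S)) F (merge_idx u v).
Proof.
rewrite pair_big /= (reindex (fun p => merge_idx (I:=I) (S:=S) p.1 p.2)) //=.
exists (fun x => (restr S x, restr (~: S) x)) => [[u v]|x] _ /=.
  by rewrite restr_merge restrC_merge.
exact: merge_restr.
Qed.

Lemma prod_setC (F : 'I_k -> C) S :
  \prod_j F j =
  (\prod_(j : {j | j \in S}) F (val j)) * \prod_(j : {j | j \in ~: S}) F (val j).
Proof.
rewrite (bigID (mem S)) /= (big_sub (mem S)); congr (_ * _).
rewrite -(big_sub (mem (~: S))); apply: eq_bigl => j.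
by rewrite inE.
Qed.

Definition fl I S (s : tensor R I) : 'M[C]_(#|sidx I S|, #|sidx I (~: S)|) :=
  \matrix_(a, b) s (merge_idx (enum_val a) (enum_val b)).

Lemma sum_rank (V : nmodType) (T : finType) (F : 'I_#|T| -> V) :
  \sum_(a : 'I_#|T|) F a = \sum_(x : T) F (enum_rank x).
Proof.
rewrite (reindex (@enum_rank T)) //; apply: onW_bij.
by exists enum_val; [exact: enum_rankK|exact: enum_valK].
Qed.

Lemma sum_val (V : nmodType) (T : finType) (F : T -> V) :
  \sum_(a : 'I_#|T|) F (enum_val a) = \sum_(x : T) F x.
Proof. by rewrite sum_rank; apply: eq_bigr => x _; rewrite enum_rankK. Qed.

Lemma normsqE I S (s : tensor R I) : normsq s = trpow (fl S s) 1.
Proof.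
rewrite trpow1E /normsq (sum_merge S) -sum_val; apply: eq_bigr => a _.
by rewrite -sum_val; apply: eq_bigr => b _; rewrite mxE.
Qed.

(** Writing x = (a, c), agreement outside [S] forces y = (b, c), so the entry is the sum over c of
    s(a, c) times the conjugate of s(b, c), normalised. This is the bridge from tensors to
    matrices. *)
Lemma ptrace_densityE I S (s : tensor R I) : ptrace S (density s) = mxden (fl S s).
Proof.
apply/matrixP => a b; rewrite !mxE.
rewrite (reindex_onto (merge_idx (enum_val a)) (restr (~: S))) /=; last first.
  by move=> x /eqP <-; rewrite merge_restr.
rewrite (eq_bigl predT); last first.
  by move=> v; rewrite restr_merge restrC_merge !eqxx.
rewrite -sum_val mulr_sumr; apply: eq_bigr => c _.
rewrite (big_pred1 (merge_idx (enum_val b) (enum_val c))); last first.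
  move=> x /=; rewrite restrC_merge; apply/andP/eqP => [[/eqP <- /eqP ->]|->].
    by rewrite merge_restr.
  by rewrite restr_merge restrC_merge.
by rewrite /density (normsqE S) mulrC !mxE.
Qed.

Lemma normsq_eq0 I (s : tensor R I) : (normsq s == 0) = (s == [ffun=> 0]).
Proof.
rewrite /normsq psumr_eq0; last by move=> x _; exact: mul_conjC_ge0.
apply/allP/eqP => [h|-> x _]; last by rewrite /= ffunE mul0r eqxx.
apply/ffunP => x; rewrite ffunE; apply/eqP.
by have := h x (mem_index_enum x); rewrite mul_conjC_eq0.
Qed.

Definition ktens I J (A : forall j, lin R (I j) (J j)) S :
    'M[C]_(#|sidx J S|, #|sidx I S|) :=
  \matrix_(a, b) \prod_(j : {j | j \in S})
     A (val j) (enum_rank ((enum_val a : sidx J S) j))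
               (enum_rank ((enum_val b : sidx I S) j)).

Lemma mergeE I S (u : sidx I S) v (j : {j | j \in S}) : merge_idx u v (val j) = u j.
Proof. by have /ffunP/(_ j) := restr_merge u v; rewrite [LHS]ffunE. Qed.

Lemma mergeCE I S (u : sidx I S) v (j : {j | j \in ~: S}) : merge_idx u v (val j) = v j.
Proof. by have /ffunP/(_ j) := restrC_merge u v; rewrite [LHS]ffunE. Qed.

(** The action is linear in the coordinates of both index groups, so the complementary factor
    appears transposed without conjugation. *)
Lemma fl_act I J (A : forall j, lin R (I j) (J j)) S (s : tensor R I) :
  fl S (act A s) = ktens A S *m fl S s *m (ktens A (~: S))^T.
Proof.
apply/matrixP => a b; rewrite !mxE ffunE (sum_merge S) exchange_big /= -sum_val.
apply: eq_bigr => d _; rewrite mxE mulr_suml -sum_val.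
apply: eq_bigr => c _; rewrite !mxE mulrAC; congr (_ * _).
rewrite (prod_setC _ S); congr (_ * _); apply: eq_bigr => j _.
  by rewrite !mergeE.
by rewrite !mergeCE.
Qed.

Lemma ktensM I J L (B : forall j, lin R (J j) (L j))
    (A : forall j, lin R (I j) (J j)) S :
  ktens B S *m ktens A S = ktens (fun j => B j *m A j) S.
Proof.
apply/matrixP => a b; rewrite !mxE.
under eq_bigr do rewrite !mxE -big_split /=.
rewrite (sum_val (fun y : sidx J S => \prod_(j : {j | j \in S})
   (B (val j) (enum_rank ((enum_val a : sidx L S) j)) (enum_rank (y j)) *
    A (val j) (enum_rank (y j)) (enum_rank ((enum_val b : sidx I S) j))))).
under [in RHS]eq_bigr do rewrite mxE sum_rank.
by rewrite big_distr_dffun.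
Qed.

Lemma ktens1 I S : ktens (fun j => 1%:M : lin R (I j) (I j)) S = 1%:M.
Proof.
apply/matrixP => a b; rewrite !mxE -(inj_eq enum_val_inj).
case: eqP => [->|ab].
  by apply: big1 => j _; rewrite mxE eqxx.
have [j hj] : exists j, (enum_val a : sidx I S) j != (enum_val b : sidx I S) j.
  apply/existsP; apply: contra_notT ab => /existsPn h; apply/ffunP => j.
  by apply/eqP; have := h j; rewrite negbK.
rewrite (bigD1 j) //= mxE (inj_eq enum_rank_inj) (negPf hj) mul0r //.
Qed.

(** One zero factor suffices. For empty [S] the empty product would give the 1 by 1 identity
    instead. *)
Lemma ktens0 I J S : S != finset.set0 ->
  ktens (fun j => 0 : lin R (I j) (J j)) S = 0.
Proof.
case/set0Pn => j hj; apply/matrixP => a b; rewrite !mxE.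
by rewrite (bigD1 (exist _ j hj)) //= mxE mul0r.
Qed.

Definition adjlin (T U : finType) (A : lin R T U) : lin R U T := A^t*.

Lemma ktens_adj I J (A : forall j, lin R (I j) (J j)) S :
  (ktens A S)^t* = ktens (fun j => adjlin (A j)) S.
Proof.
apply/matrixP => a b; rewrite !mxE rmorph_prod; apply: eq_bigr => j _.
by rewrite !mxE.
Qed.

Lemma act_comp I J L (B : forall j, lin R (J j) (L j))
    (A : forall j, lin R (I j) (J j)) s :
  act B (act A s) = act (fun j => B j *m A j) s.
Proof.
apply/ffunP => z; rewrite !ffunE.
under eq_bigr do rewrite ffunE mulr_sumr.
rewrite exchange_big /=; apply: eq_bigr => x _.
under eq_bigr do rewrite mulrA -big_split /=.
rewrite -mulr_suml; congr (_ * _).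
under [RHS]eq_bigr do rewrite mxE sum_rank.
by rewrite big_distr_dffun.
Qed.

Lemma act1 I (s : tensor R I) : act (fun j => 1%:M : lin R (I j) (I j)) s = s.
Proof.
apply/ffunP => y; rewrite ffunE (bigD1 y) //= big1 => [|j _]; last by rewrite mxE eqxx.
rewrite mul1r big1 ?addr0 // => x xy.
have [j hj] : exists j, y j != x j.
  apply/existsP; apply: contraNT xy => /existsPn h; apply/eqP/ffunP => j.
  by apply/eqP; have := h j; rewrite negbK eq_sym.
by rewrite (bigD1 j) //= mxE (inj_eq enum_rank_inj) (negPf hj) !mul0r.
Qed.

Lemma act0 I J (A : forall j, lin R (I j) (J j)) : act A [ffun=> 0] = [ffun=> 0].
Proof.
by apply/ffunP => y; rewrite !ffunE big1 // => x _; rewrite ffunE mulr0.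
Qed.

Lemma act_unit_neq0 I (A : forall j, lin R (I j) (I j)) (s : tensor R I) :
  (forall j, A j \in unitmx) -> s != [ffun=> 0] -> act A s != [ffun=> 0].
Proof.
move=> uA; apply: contraNneq => h.
rewrite -[s]act1; have -> : act (fun j => 1%:M) s = act (fun j => invmx (A j)) (act A s).
  rewrite act_comp; congr (act _ s); apply: functional_extensionality_dep => j.
  exact/esym/mulVmx/uA.
by rewrite h act0.
Qed.

End Flattening.

(** * Matrix identities for power traces *)

Section MatrixMoments.
Variable R : realType.
Local Notation C := (complex R).
Local Open Scope sesquilinear_scope.

Lemma adj_trmx m n (A : 'M[C]_(m, n)) : (A^T)^t* = (A^t* )^T.
Proof. by apply/matrixP => i j; rewrite !mxE. Qed.

Lemma adjmxD m n (A B : 'M[C]_(m, n)) : (A + B)^t* = A^t* + B^t*.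
Proof. by apply/matrixP => i j; rewrite !mxE rmorphD. Qed.

Lemma trpow_gram n n' p p' q r (X : 'M[C]_(n, q)) (X' : 'M[C]_(n', q))
    (N : 'M[C]_(q, r)) (Y : 'M[C]_(r, p)) (Y' : 'M[C]_(r, p')) m :
  X^t* *m X = X'^t* *m X' -> Y *m Y^t* = Y' *m Y'^t* ->
  trpow (X *m N *m Y) m.+1 = trpow (X' *m N *m Y') m.+1.
Proof.
move=> eX eY.
(* Rotating [Z] to the end of the cyclic word brings it next to its adjoint, so the outer factors
   survive only through their Gram matrices and their outer sizes disappear. *)
have red a b (Z : 'M[C]_(a, q)) (W : 'M[C]_(r, b)) :
    trpow (Z *m N *m W) m.+1 =
    \tr ((N *m (W *m W^t* ) *m N^t* *m (Z^t* *m Z)) ^+ m.+1).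
  rewrite /trpow !adjmxM -!mulmxA mxtrace_mul_powC -!mulmxA //.
by rewrite !red eX eY.
Qed.

(** A rank bound without ranks: [X] is exchanged for a square matrix of size [r] with the same Gram
    matrix, which makes the density matrix [r] by [r] without changing power traces. *)
Lemma entropy_le_inner n p r (X : 'M[C]_(n, r)) (Y : 'M[C]_(r, p)) :
  trpow (X *m Y) 1 != 0 -> entropy (mxden (X *m Y)) <= log2 r%:R.
Proof.
have [B [_ [eB _]]] := gram_square_root X.
have e m : trpow (X *m Y) m.+1 = trpow (B *m Y) m.+1.
  have := @trpow_gram _ _ _ _ _ _ X B 1%:M Y Y m (esym eB) erefl.
  by rewrite !mulmx1.
move=> N0; have N0' : trpow (B *m Y) 1 != 0 by rewrite -e.
rewrite (eq_entropy_nmom N0 N0') ?entropy_le_dim // => m.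
by rewrite /nmom !e.
Qed.

(** Factoring through the identity of size [p] stands in for the equality of the entropies of the
    two complementary marginals. *)
Lemma entropy_le_codim n p (M : 'M[C]_(n, p)) : trpow M 1 != 0 ->
  entropy (mxden M) <= log2 p%:R.
Proof. by rewrite -[M]mulmx1 => /entropy_le_inner. Qed.

Lemma trpow_block n p n1 p1 n2 p2 (E1 : 'M[C]_(n, n1)) (E2 : 'M[C]_(n, n2))
    (G1 : 'M[C]_(p1, p)) (G2 : 'M[C]_(p2, p))
    (M1 : 'M[C]_(n1, p1)) (M2 : 'M[C]_(n2, p2)) m :
  E1^t* *m E1 = 1%:M -> E2^t* *m E2 = 1%:M -> E1^t* *m E2 = 0 ->
  G1 *m G1^t* = 1%:M -> G2 *m G2^t* = 1%:M -> G1 *m G2^t* = 0 ->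
  trpow (E1 *m M1 *m G1 + E2 *m M2 *m G2) m.+1 =
  trpow M1 m.+1 + trpow M2 m.+1.
Proof.
move=> e11 e22 e12 g11 g22 g12.
have e21 : E2^t* *m E1 = 0.
  by rewrite -(trmxCK E1) -adjmxM e12 trmx0 map_mx0.
have g21 : G2 *m G1^t* = 0.
  by rewrite -(trmxCK G2) -adjmxM g12 trmx0 map_mx0.
set K1 := M1 *m M1^t*; set K2 := M2 *m M2^t*.
have gE : (E1 *m M1 *m G1 + E2 *m M2 *m G2) *m (E1 *m M1 *m G1 + E2 *m M2 *m G2)^t*
    = E1 *m K1 *m E1^t* + E2 *m K2 *m E2^t*.
  have kill a b c d x (A : 'M[C]_(a, b)) (G : 'M[C]_(b, x)) (G' : 'M[C]_(x, c))
     (A' : 'M[C]_(c, d)) (Z : 'M[C]_(b, c)) : G *m G' = Z ->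
     A *m G *m (G' *m A') = A *m Z *m A'.
    by move=> <-; rewrite !mulmxA.
  rewrite adjmxD !adjmxM mulmxDl !mulmxDr.
  rewrite (kill _ _ _ _ _ _ _ _ _ _ g11) (kill _ _ _ _ _ _ _ _ _ _ g12).
  rewrite (kill _ _ _ _ _ _ _ _ _ _ g21) (kill _ _ _ _ _ _ _ _ _ _ g22).
  by rewrite !mulmx0 !mul0mx addr0 add0r !mulmx1 /K1 /K2 !mulmxA.
have powE q : (E1 *m K1 *m E1^t* + E2 *m K2 *m E2^t* ) ^+ q.+1 =
    E1 *m K1 ^+ q.+1 *m E1^t* + E2 *m K2 ^+ q.+1 *m E2^t*.
  elim: q => [|q IH]; first by rewrite !expr1.
  have kill a b c d x y (A : 'M[C]_(a, b)) (G : 'M[C]_(b, x)) (G' : 'M[C]_(x, c))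
     (A' : 'M[C]_(c, d)) (B' : 'M[C]_(d, y)) (Z : 'M[C]_(b, c)) : G *m G' = Z ->
     A *m G *m (G' *m A' *m B') = A *m Z *m A' *m B'.
    by move=> <-; rewrite !mulmxA.
  rewrite mxpowS IH mulmxDl !mulmxDr.
  rewrite (kill _ _ _ _ _ _ _ _ _ _ _ _ e11) (kill _ _ _ _ _ _ _ _ _ _ _ _ e12).
  rewrite (kill _ _ _ _ _ _ _ _ _ _ _ _ e21) (kill _ _ _ _ _ _ _ _ _ _ _ _ e22).
  rewrite !mulmx0 !mul0mx addr0 add0r !mulmx1.
  by rewrite (mxpowS K1 q.+1) (mxpowS K2 q.+1) !mulmxA.
rewrite /trpow gE powE raddfD /=; congr (_ + _).
  by rewrite mxtrace_mulC mulmxA e11 mul1mx.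
by rewrite mxtrace_mulC mulmxA e22 mul1mx.
Qed.

Lemma trpowZ n p (c : C) (M : 'M[C]_(n, p)) m :
  trpow (c *: M) m = (c * c^*) ^+ m * trpow M m.
Proof.
rewrite /trpow adjmxZ -scalemxAl -scalemxAr scalerA mxpowZ.
by rewrite mxtraceZ.
Qed.

Lemma mxdenZ n p (c : C) (M : 'M[C]_(n, p)) : c != 0 -> mxden (c *: M) = mxden M.
Proof.
move=> c0; rewrite /mxden trpowZ adjmxZ -scalemxAl -scalemxAr !scalerA expr1 -mulrA.
have : c * c^* != 0 by rewrite mulf_neq0 // conjC_eq0.
by move: (c * _) => d d0; rewrite invfM mulrAC mulVf // mul1r.
Qed.

Lemma Re_trpowM n p (M : 'M[C]_(n, p)) m (y : C) :
  complex.Re (trpow M m * y) = complex.Re (trpow M m) * complex.Re y.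
Proof. by rewrite Re_mul {2}trpow_real /= mul0r subr0. Qed.

End MatrixMoments.

(** * Direct sums and tensor products *)

Section Pairs.
Variables (K : finType) (T U : K -> finType).

Definition dfst (z : {dffun forall i, (T i * U i)%type}) : {dffun forall i, T i} :=
  [ffun i => (z i).1].
Definition dsnd (z : {dffun forall i, (T i * U i)%type}) : {dffun forall i, U i} :=
  [ffun i => (z i).2].
Definition dpair (x : {dffun forall i, T i}) (y : {dffun forall i, U i}) :
    {dffun forall i, (T i * U i)%type} := [ffun i => (x i, y i)].

Lemma dfst_pair x y : dfst (dpair x y) = x.
Proof. by apply/ffunP => i; rewrite !ffunE. Qed.

Lemma dsnd_pair x y : dsnd (dpair x y) = y.
Proof. by apply/ffunP => i; rewrite !ffunE. Qed.

Lemma dpairK z : dpair (dfst z) (dsnd z) = z.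
Proof. by apply/ffunP => i; rewrite !ffunE; case: (z i). Qed.

Lemma sum_dpair (V : nmodType) (F : {dffun forall i, (T i * U i)%type} -> V) :
  \sum_z F z = \sum_x \sum_y F (dpair x y).
Proof.
rewrite pair_big /= (reindex (fun p => dpair p.1 p.2)) //=.
exists (fun z => (dfst z, dsnd z)) => [[x y]|z] _ /=.
  by rewrite dfst_pair dsnd_pair.
exact: dpairK.
Qed.

End Pairs.

Section Constructions.
Variables (R : realType) (k : nat).
Local Notation C := (complex R).
Local Open Scope sesquilinear_scope.
Implicit Types (I J L : 'I_k -> finType) (S : {set 'I_k}).

(** * Direct sums through coordinate inclusions *)

Definition emb (T U : finType) (f : T -> U) : lin R T U :=
  \matrix_(a, b) ((enum_val a : U) == f (enum_val b))%:R.

Lemma emb_adjM (T U W : finType) (f : T -> W) (g : U -> W) a b :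
  (adjlin (emb f) *m emb g) a b = (f (enum_val a) == g (enum_val b))%:R.
Proof.
rewrite mxE (bigD1 (enum_rank (f (enum_val a)))) //= big1 => [|c hc].
  by rewrite !mxE enum_rankK eqxx conjC1 mul1r addr0.
rewrite !mxE -(inj_eq enum_rank_inj) enum_valK.
by rewrite (negPf hc) conjC0 mul0r.
Qed.

Lemma emb_inj (T U : finType) (f : T -> U) : injective f ->
  adjlin (emb f) *m emb f = 1%:M.
Proof.
move=> fi; apply/matrixP => a b; rewrite emb_adjM mxE.
by rewrite (inj_eq fi) (inj_eq enum_val_inj).
Qed.

Lemma emb_disj (T U W : finType) (f : T -> W) (g : U -> W) :
  (forall x y, f x != g y) -> adjlin (emb f) *m emb g = 0.
Proof. by move=> h; apply/matrixP => a b; rewrite emb_adjM mxE (negPf (h _ _)). Qed.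

Lemma act_emb I J (f : forall j, I j -> J j) (s : tensor R I) z :
  act (fun j => emb (@f j)) s z = \sum_(x : idx I | [forall j, z j == f j (x j)]) s x.
Proof.
rewrite ffunE [RHS]big_mkcond /=; apply: eq_bigr => x _.
case: ifP => [/forallP h|/negbT].
  by rewrite big1 ?mul1r // => j _; rewrite !mxE !enum_rankK h.
rewrite negb_forall => /existsP[j hj].
by rewrite (bigD1 j) //= !mxE !enum_rankK (negPf hj) !mul0r.
Qed.

Definition dsI I J : 'I_k -> finType := fun j => (I j + J j)%type.

Definition il I J j : lin R (I j) (dsI I J j) := emb (@inl (I j) (J j)).
Definition ir I J j : lin R (J j) (dsI I J j) := emb (@inr (I j) (J j)).

(** Exhibits both summands as images under local maps, so that direct sums are handled by [act_comp]
    and [fl_act]. *)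
Lemma dsumE I J (s : tensor R I) (t : tensor R J) :
  dsum s t = [ffun z : idx (dsI I J) => act (il I J) s z + act (ir I J) t z].
Proof.
apply/ffunP => z; rewrite [LHS]ffunE [RHS]ffunE; congr (_ + _).
  exact/esym/(act_emb (fun j => @inl (I j) (J j)) s z).
exact/esym/(act_emb (fun j => @inr (I j) (J j)) t z).
Qed.

Definition dslin I J j (A : lin R (I j) (I j)) (B : lin R (J j) (J j)) :
    lin R (dsI I J j) (dsI I J j) :=
  il I J j *m A *m adjlin (il I J j) + ir I J j *m B *m adjlin (ir I J j).

Lemma ilil I J j : adjlin (il I J j) *m il I J j = 1%:M :> lin R (I j) (I j).
Proof. by apply: emb_inj => x y []. Qed.
Lemma irir I J j : adjlin (ir I J j) *m ir I J j = 1%:M :> lin R (J j) (J j).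
Proof. by apply: emb_inj => x y []. Qed.
Lemma ilir I J j : adjlin (il I J j) *m ir I J j = 0 :> lin R (J j) (I j).
Proof. exact: emb_disj. Qed.
Lemma iril I J j : adjlin (ir I J j) *m il I J j = 0 :> lin R (I j) (J j).
Proof. exact: emb_disj. Qed.

Lemma dslin_il I J j (A : lin R (I j) (I j)) (B : lin R (J j) (J j)) :
  dslin A B *m il I J j = il I J j *m A.
Proof.
rewrite /dslin mulmxDl -!mulmxA ilil iril.
by rewrite !mulmx0 addr0 mulmx1.
Qed.

Lemma dslin_ir I J j (A : lin R (I j) (I j)) (B : lin R (J j) (J j)) :
  dslin A B *m ir I J j = ir I J j *m B.
Proof.
rewrite /dslin mulmxDl -!mulmxA irir ilir.
by rewrite !mulmx0 add0r mulmx1.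
Qed.

Lemma il_ir_split I J j :
  il I J j *m adjlin (il I J j) + ir I J j *m adjlin (ir I J j) = 1%:M.
Proof.
apply/matrixP => a b; rewrite !mxE -(inj_eq enum_val_inj).
rewrite !sum_rank.
under eq_bigr do rewrite !mxE enum_rankK conjC_nat -natrM mulnb.
under [X in _ + X]eq_bigr do rewrite !mxE enum_rankK conjC_nat -natrM mulnb.
case: (enum_val a) => x; case: (enum_val b) => y.
- rewrite [X in _ + X]big1 // addr0 (bigD1 x) //= eqxx big1 => [|z zx].
    by rewrite addr0 eq_sym.
  by rewrite (inj_eq (@inl_inj _ _)) eq_sym (negPf zx).
- by rewrite !big1 ?addr0 // => z _; rewrite andbC.
- by rewrite !big1 ?addr0 // => z _; rewrite andbC.
- rewrite [X in X + _]big1 // add0r (bigD1 x) //= eqxx big1 => [|z zx].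
    by rewrite addr0 eq_sym.
  by rewrite (inj_eq (@inr_inj _ _)) eq_sym (negPf zx).
Qed.

Lemma dslin_unit I J j (A : lin R (I j) (I j)) (B : lin R (J j) (J j)) :
  A \in unitmx -> B \in unitmx -> dslin A B \in unitmx.
Proof.
move=> uA uB; suff /mulmx1_unit[] : dslin A B *m dslin (invmx A) (invmx B) = 1%:M by [].
rewrite {2}/dslin mulmxDr !mulmxA dslin_il dslin_ir.
by rewrite -(mulmxA _ A) mulmxV // -(mulmxA _ B) mulmxV // !mulmx1 il_ir_split.
Qed.

Lemma actD I J (A : forall j, lin R (I j) (J j)) (s t : tensor R I) :
  act A [ffun x => s x + t x] = [ffun x => act A s x + act A t x].
Proof.
apply/ffunP => y; rewrite !ffunE -big_split /=; apply: eq_bigr => x _.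
by rewrite ffunE mulrDr.
Qed.

Lemma act_dsum I J (A : forall j, lin R (I j) (I j)) (B : forall j, lin R (J j) (J j))
    (s : tensor R I) (t : tensor R J) :
  act (fun j => dslin (A j) (B j)) (dsum s t) = dsum (act A s) (act B t).
Proof.
rewrite !dsumE actD !act_comp; apply/ffunP => z; rewrite [LHS]ffunE [RHS]ffunE.
congr (_ + _); congr ((act _ _) z); apply: functional_extensionality_dep => j.
  exact: dslin_il.
exact: dslin_ir.
Qed.

Lemma flD I S (s t : tensor R I) : fl S [ffun x => s x + t x] = fl S s + fl S t.
Proof. by apply/matrixP => a b; rewrite !mxE ffunE. Qed.

Lemma eq_ktens I J (A B : forall j, lin R (I j) (J j)) S :
  (forall j, A j = B j) -> ktens A S = ktens B S.
Proof. by move=> h; have -> : A = B by exact: functional_extensionality_dep. Qed.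

(** The inclusions induce isometries on both sides of the flattening. Nonempty [S] makes their
    ranges orthogonal on the left, nonempty complement on the right; both are hypotheses of
    [trpow_block]. *)
Lemma trpow_dsum I J S (s : tensor R I) (t : tensor R J) m :
  S != finset.set0 -> ~: S != finset.set0 ->
  trpow (fl S (dsum s t)) m.+1 = trpow (fl S s) m.+1 + trpow (fl S t) m.+1.
Proof.
move=> S0 SC0; rewrite dsumE flD !fl_act.
have ll Q : (ktens (il I J) Q)^t* *m ktens (il I J) Q = 1%:M.
  rewrite ktens_adj ktensM -ktens1; apply: eq_ktens => j.
  exact: ilil.
have rr Q : (ktens (ir I J) Q)^t* *m ktens (ir I J) Q = 1%:M.
  rewrite ktens_adj ktensM -ktens1; apply: eq_ktens => j.
  exact: irir.
have lr Q : Q != finset.set0 -> (ktens (il I J) Q)^t* *m ktens (ir I J) Q = 0.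
  move=> Q0; rewrite ktens_adj ktensM -(ktens0 R J I Q0); apply: eq_ktens => j.
  exact: ilir.
have rl Q : Q != finset.set0 -> (ktens (ir I J) Q)^t* *m ktens (il I J) Q = 0.
  move=> Q0; rewrite ktens_adj ktensM -(ktens0 R I J Q0); apply: eq_ktens => j.
  exact: iril.
apply: trpow_block => //; first exact: lr.
- by rewrite adj_trmx -trmx_mul ll trmx1.
- by rewrite adj_trmx -trmx_mul rr trmx1.
- by rewrite adj_trmx -trmx_mul rl // trmx0.
Qed.

(** * Tensor products and Kronecker products of local maps *)

Definition tpI I J : 'I_k -> finType := fun j => (I j * J j)%type.

Definition tplin (T U T' U' : finType) (A : lin R T T') (B : lin R U U') :
    lin R (T * U)%type (T' * U')%type :=
  \matrix_(a, b)
    (A (enum_rank (enum_val a : T' * U').1) (enum_rank (enum_val b : T * U).1) *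
     B (enum_rank (enum_val a : T' * U').2) (enum_rank (enum_val b : T * U).2)).

Lemma tplinM (T U T' U' T'' U'' : finType) (A : lin R T T') (B : lin R U U')
   (A' : lin R T' T'') (B' : lin R U' U'') :
  tplin A' B' *m tplin A B = tplin (A' *m A) (B' *m B).
Proof.
apply/matrixP => a b; rewrite !mxE big_distrlr /= sum_rank.
transitivity (\sum_(x : T') \sum_(y : U')
    tplin A' B' a (enum_rank (x, y)) * tplin A B (enum_rank (x, y)) b).
  by rewrite pair_bigA; apply: eq_bigr => -[x y] _.
rewrite sum_rank; apply: eq_bigr => x _.
rewrite sum_rank; apply: eq_bigr => y _.
by rewrite !mxE !enum_rankK /= mulrACA.
Qed.

Lemma tplin1 (T U : finType) : tplin (1%:M : lin R T T) (1%:M : lin R U U) = 1%:M.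
Proof.
apply/matrixP => a b; rewrite !mxE !(inj_eq enum_rank_inj).
rewrite -[a == b](inj_eq enum_val_inj).
case: (enum_val a) => x y; case: (enum_val b) => x' y'.
by rewrite -natrM mulnb xpair_eqE.
Qed.

Lemma tplin_unit (T U : finType) (A : lin R T T) (B : lin R U U) :
  A \in unitmx -> B \in unitmx -> tplin A B \in unitmx.
Proof.
move=> uA uB; suff /mulmx1_unit[] : tplin A B *m tplin (invmx A) (invmx B) = 1%:M by [].
by rewrite tplinM !mulmxV // tplin1.
Qed.

Lemma tprodE I J (s : tensor R I) (t : tensor R J) (z : idx (tpI I J)) :
  tprod s t z = s (dfst z) * t (dsnd z).
Proof. by rewrite ffunE. Qed.

Lemma act_tprod I J (A : forall j, lin R (I j) (I j)) (B : forall j, lin R (J j) (J j))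
    (s : tensor R I) (t : tensor R J) :
  act (fun j => tplin (A j) (B j)) (tprod s t) = tprod (act A s) (act B t).
Proof.
apply/ffunP => z; rewrite [RHS]tprodE ffunE [X in _ = X * _]ffunE [X in _ = _ * X]ffunE.
rewrite big_distrlr /= (sum_dpair (T := I) (U := J)); apply: eq_bigr => x _.
apply: eq_bigr => y _; rewrite tprodE dfst_pair dsnd_pair mulrACA; congr (_ * _).
rewrite -big_split /=; apply: eq_bigr => j _.
by rewrite !mxE !enum_rankK !ffunE.
Qed.

Lemma dfst_merge I J S (u : sidx (tpI I J) S) v :
  dfst (merge_idx u v) = merge_idx (I := I) (dfst u) (dfst v).
Proof. by apply/ffunP => j; rewrite !ffunE; case: (decP _) => h; rewrite ffunE. Qed.

Lemma dsnd_merge I J S (u : sidx (tpI I J) S) v :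
  dsnd (merge_idx u v) = merge_idx (I := J) (dsnd u) (dsnd v).
Proof. by apply/ffunP => j; rewrite !ffunE; case: (decP _) => h; rewrite ffunE. Qed.

(** Up to reordering the basis, the Gram matrix is a Kronecker product. The induction on [m]
    compares entries of powers along [dfst] and [dsnd], which avoids permutation matrices. *)
Lemma trpow_tprod I J S (s : tensor R I) (t : tensor R J) m :
  trpow (fl S (tprod s t)) m = trpow (fl S s) m * trpow (fl S t) m.
Proof.
pose G := fl S (tprod s t) *m (fl S (tprod s t))^t*.
pose G1 := fl S s *m (fl S s)^t*; pose G2 := fl S t *m (fl S t)^t*.
have h (z z' : sidx (tpI I J) S) : (G ^+ m) (enum_rank z) (enum_rank z') =
   (G1 ^+ m) (enum_rank (dfst z)) (enum_rank (dfst z')) *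
   (G2 ^+ m) (enum_rank (dsnd z)) (enum_rank (dsnd z')).
  elim: m z z' => [|m IH] z z'.
    rewrite !expr0 !mxE !(inj_eq enum_rank_inj) -natrM mulnb; congr (_%:R : C).
    congr nat_of_bool.
    apply/eqP/andP => [->|[/eqP h1 /eqP h2]]; first by rewrite !eqxx.
    by rewrite -(dpairK z) -(dpairK z') h1 h2.
  rewrite !mxpowS !mxE !sum_rank big_distrlr /=.
  rewrite (sum_dpair (T := fun j : {j | j \in S} => I (val j))
    (U := fun j : {j | j \in S} => J (val j))).
  apply: eq_bigr => x _; apply: eq_bigr => y _.
  rewrite IH dfst_pair dsnd_pair mulrACA; congr (_ * _).
  rewrite /G /G1 /G2 !mxE !sum_rank big_distrlr /=.
  rewrite (sum_dpair (T := fun j : {j | j \in ~: S} => I (val j))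
    (U := fun j : {j | j \in ~: S} => J (val j))).
  apply: eq_bigr => c _; apply: eq_bigr => d _.
  rewrite !mxE !enum_rankK !tprodE !dfst_merge !dsnd_merge !dfst_pair !dsnd_pair.
  by rewrite rmorphM /= mulrACA.
rewrite /trpow -/G -/G1 -/G2 /mxtrace !sum_rank big_distrlr /=.
rewrite (sum_dpair (T := fun j : {j | j \in S} => I (val j))
    (U := fun j : {j | j \in S} => J (val j))).
apply: eq_bigr => x _; apply: eq_bigr => y _.
by rewrite h dfst_pair dsnd_pair.
Qed.

End Constructions.

(** * Entropies of the marginals *)

Section Entropies.
Variables (R : realType) (k : nat).
Local Notation C := (complex R).
Local Open Scope sesquilinear_scope.
Implicit Types (I J L : 'I_k -> finType) (S : {set 'I_k}).

Definition entS I S (s : tensor R I) : R := entropy (mxden (fl S s)).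

Definition nsq I (s : tensor R I) : R := complex.Re (normsq s).

Lemma Re_trpow1 I S (s : tensor R I) : complex.Re (trpow (fl S s) 1) = nsq s.
Proof. by rewrite /nsq (normsqE S). Qed.

Lemma trpow1_neq0 I S (s : tensor R I) : s != [ffun=> 0] -> trpow (fl S s) 1 != 0.
Proof. by rewrite -normsqE normsq_eq0. Qed.

Lemma nsq_gt0 I (s : tensor R I) : s != [ffun=> 0] -> 0 < nsq s.
Proof.
move=> /(trpow1_neq0 finset.set0) h; rewrite -(Re_trpow1 finset.set0).
rewrite lt_def trpow1_ge0 andbT; apply: contraNneq h => h.
by rewrite trpow_real h.
Qed.

Lemma nmom_flE I S (s : tensor R I) m :
  nmom (fl S s) m = complex.Re (trpow (fl S s) m) / nsq s ^+ m.
Proof. by rewrite /nmom Re_trpow1. Qed.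

(** The products [l i * u j] have the right power sums, hence serve as spectrum; [shannonM] together
    with total mass 1 of both families gives additivity. *)
Lemma entS_tprod I J S (s : tensor R I) (t : tensor R J) :
  s != [ffun=> 0] -> t != [ffun=> 0] -> entS S (tprod s t) = entS S s + entS S t.
Proof.
move=> s0 t0.
have [l [hl l1 hl' eS]] := mxden_spectrum (trpow1_neq0 S s0).
have [u [hu u1 hu' eT]] := mxden_spectrum (trpow1_neq0 S t0).
rewrite [entS S s]eS [entS S t]eT -mulrDl.
rewrite /entS (entropy_mxden (T := ('I__ * 'I__)%type) (u := fun p => l p.1 * u p.2)).
- congr (_ / _); rewrite -(pair_bigA _ (fun i j => shannon (l i * u j))) /=.
  transitivity (\sum_i \sum_j (l i * shannon (u j) + u j * shannon (l i))).
    apply: eq_bigr => i _; apply: eq_bigr => j _; apply: shannonM.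
      by case/andP: (hl i).
    by case/andP: (hu j).
  transitivity (\sum_i (l i * (\sum_j shannon (u j)) + shannon (l i))).
    apply: eq_bigr => i _; rewrite big_split /= -mulr_sumr -mulr_suml u1 mul1r //.
  by rewrite big_split /= -mulr_suml l1 mul1r addrC.
- by rewrite trpow_tprod mulf_neq0 // trpow1_neq0.
- move=> [i j] /=; have /andP[a b] := hl i; have /andP[c d] := hu j.
  by rewrite mulr_ge0 //= mulr_ile1.
- move=> m; rewrite -(pair_bigA _ (fun i j => (l i * u j) ^+ m.+1)) /=.
  under eq_bigr do under eq_bigr do rewrite exprMn.
  rewrite -big_distrlr /= -hl' -hu' /nmom !trpow_tprod.
  by rewrite !Re_trpowM exprMn invfM mulrACA.
Qed.

Lemma nsq_dsum I J S (s : tensor R I) (t : tensor R J) :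
  S != finset.set0 -> ~: S != finset.set0 -> nsq (dsum s t) = nsq s + nsq t.
Proof. by move=> S0 SC0; rewrite -!(Re_trpow1 S) trpow_dsum // Re_add. Qed.

(** The two spectra, scaled by [p] and [1 - p] and put side by side, have the right power sums;
    [shannonM] then splits off the binary entropy of [p]. The weight [p] does not involve [S]. *)
Lemma entS_dsum I J S (s : tensor R I) (t : tensor R J) (p : R) :
  S != finset.set0 -> ~: S != finset.set0 ->
  s != [ffun=> 0] -> t != [ffun=> 0] -> p = nsq s / (nsq s + nsq t) ->
  entS S (dsum s t) =
    p * entS S s + (1 - p) * entS S t + (shannon p + shannon (1 - p)) / ln 2.
Proof.
move=> S0 SC0 s0 t0 pE.
have [l [hl l1 hl' eS]] := mxden_spectrum (trpow1_neq0 S s0).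
have [u [hu u1 hu' eT]] := mxden_spectrum (trpow1_neq0 S t0).
have ns := nsq_gt0 s0; have nt := nsq_gt0 t0.
have n0 : nsq s + nsq t != 0 by rewrite gt_eqF ?addr_gt0.
have qE : 1 - p = nsq t / (nsq s + nsq t) by rewrite pE; field.
have p0 : 0 <= p by rewrite pE divr_ge0 ?ltW ?addr_gt0.
have q0 : 0 <= 1 - p by rewrite qE divr_ge0 ?ltW ?addr_gt0.
rewrite [entS S s]eS [entS S t]eT !mulrA -!mulrDl.
rewrite /entS (entropy_mxden (T := ('I__ + 'I__)%type)
   (u := fun x => match x with inl i => p * l i | inr i => (1 - p) * u i end)).
- congr (_ / _); rewrite big_sumType /=.
  under eq_bigr => i _ do rewrite shannonM ?(andP (hl i)).1 //.
  under [X in _ + X]eq_bigr => i _ do rewrite shannonM ?(andP (hu i)).1 //.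
  rewrite !big_split /= -!mulr_sumr -!mulr_suml l1 u1 !mul1r.
  by rewrite addrACA.
- rewrite trpow_dsum // -!normsqE gt_eqF // addr_gt0 // lt_def.
  + by rewrite normsq_eq0 s0; apply: sumr_ge0 => x _; exact: mul_conjC_ge0.
  + by rewrite normsq_eq0 t0; apply: sumr_ge0 => x _; exact: mul_conjC_ge0.
- case=> i; [have /andP[a b] := hl i|have /andP[a b] := hu i].
    by rewrite mulr_ge0 //= mulr_ile1 // -subr_ge0.
  by rewrite mulr_ge0 //= mulr_ile1 // lerBlDr lerDl.
- move=> m; rewrite big_sumType /=.
  under eq_bigr do rewrite exprMn.
  under [X in _ = _ + X]eq_bigr do rewrite exprMn.
  rewrite -!mulr_sumr -hl' -hu' !nmom_flE trpow_dsum // (nsq_dsum _ _ S0) // Re_add.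
  rewrite qE pE !expr_div_n mulrDl.
  have : nsq s ^+ m.+1 != 0 by rewrite expf_neq0 // gt_eqF.
  have : nsq t ^+ m.+1 != 0 by rewrite expf_neq0 // gt_eqF.
  have : (nsq s + nsq t) ^+ m.+1 != 0 by rewrite expf_neq0.
  move: (nsq s ^+ m.+1) (nsq t ^+ m.+1) ((nsq s + nsq t) ^+ m.+1) => x y z z0 y0 x0.
  by congr (_ + _); field; rewrite ?x0 ?y0 z0.
Qed.

Lemma entS_le I S (s : tensor R I) : s != [ffun=> 0] ->
  entS S s <= log2 (minn (sdim I S) (sdim I (~: S)))%:R.
Proof.
move=> s0; rewrite /minn; case: ifP => _.
  exact: entropy_le_dim (trpow1_neq0 S s0).
exact: entropy_le_codim (trpow1_neq0 S s0).
Qed.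

Lemma sdim_gt0 I S (s : tensor R I) : s != [ffun=> 0] -> (0 < sdim I S)%N.
Proof.
move=> s0; case: (pickP (fun x : idx I => true)) => [x _|h].
  by apply/card_gt0P; exists (restr S x).
by case/eqP: s0; apply/ffunP => x; have := h x.
Qed.

(** * Flattenings of unit tensors *)

Definition diagmx r S : 'M[C]_(#|sidx (fun _ => 'I_r : finType) S|, r) :=
  \matrix_(a, i) \prod_(j : {j | j \in S})
    ((enum_val a : sidx (fun _ => 'I_r : finType) S) j == i)%:R.

(** A Schmidt decomposition: [diagmx] sends e_i to the product of copies of e_i over the legs in
    [S], and different i are not coupled. *)
Lemma fl_unit r S : fl S (unit_tensor R k r) = diagmx r S *m (diagmx r (~: S))^T.
Proof.
apply/matrixP => a b; rewrite !mxE ffunE; apply: eq_bigr => i _.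
rewrite (prod_setC _ S) !mxE; congr (_ * _); apply: eq_bigr => j _.
  by rewrite mergeE.
by rewrite mergeCE.
Qed.

(** Any single leg in [S] already separates two different columns; for empty [S] all columns would
    coincide. *)
Lemma diagmx_isom r S : S != finset.set0 -> (diagmx r S)^t* *m diagmx r S = 1%:M.
Proof.
case/set0Pn => j0 hj0; apply/matrixP => i i'; rewrite !mxE.
under eq_bigr do rewrite adjmxE !mxE rmorph_prod -big_split /=.
rewrite (sum_val (fun y : sidx (fun _ => 'I_r : finType) S => \prod_(j : {j | j \in S})
   (((y j == i)%:R : C)^* * (y j == i')%:R))).
rewrite -(big_distr_dffun (fun (j : {j | j \in S}) (x : 'I_r) =>
    ((x == i)%:R : C)^* * (x == i')%:R)).
have e (j : {j | j \in S}) :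
    \sum_(x : 'I_r) ((x == i)%:R : C)^* * (x == i')%:R = (i == i')%:R.
  rewrite (bigD1 i) //= eqxx conjC1 mul1r big1 ?addr0 // => x /negPf ->.
  by rewrite conjC0 mul0r.
rewrite (eq_bigr (fun=> (i == i')%:R)) => [|j _]; last exact: (e j).
case: eqP => _; first by rewrite big1.
by rewrite (bigD1 (exist _ j0 hj0)) //= mul0r.
Qed.

Lemma trpow_unit r S m : S != finset.set0 -> ~: S != finset.set0 ->
  trpow (fl S (unit_tensor R k r)) m.+1 = r%:R.
Proof.
(* The inserted identity produces the shape of [trpow_gram], which then replaces both isometries by
   identities on C^r. *)
move=> S0 SC0; rewrite fl_unit -[X in X *m _](mulmx1 (diagmx r S)).
rewrite (trpow_gram (X' := 1%:M : 'M[C]_r) 1%:M (Y' := 1%:M : 'M[C]_r) m).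
- rewrite !mulmx1 /trpow trmx1 map_mx1 mulmx1 expr1n.
  by rewrite mxtrace1.
- by rewrite diagmx_isom // trmx1 map_mx1 mulmx1.
- by rewrite adj_trmx -trmx_mul diagmx_isom // !trmx1 map_mx1 mulmx1.
Qed.

Lemma entS_unit r S : (0 < r)%N -> S != finset.set0 -> ~: S != finset.set0 ->
  entS S (unit_tensor R k r) = log2 r%:R.
Proof.
move=> r0 S0 SC0; have rn0 : r%:R != 0 :> R by rewrite pnatr_eq0 -lt0n.
have ReN : complex.Re (r%:R : C) = r%:R.
  by rewrite -(rmorph_nat (real_complex R)).
rewrite /entS (entropy_mxden (T := 'I_r) (u := fun=> r%:R^-1)).
- rewrite sumr_const card_ord /log2; congr (_ / _).
  rewrite /shannon lnV ?posrE ?ltr0n // mulrN opprK.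
  rewrite -[(_ * _) *+ r]mulr_natl mulrA mulfV //.
  by rewrite mul1r.
- by rewrite trpow_unit // pnatr_eq0 -lt0n.
- by move=> _; rewrite invr_ge0 ler0n /= invf_le1 ?ltr0n // ler1n.
- move=> m; rewrite /nmom !trpow_unit // ReN sumr_const card_ord exprVn.
  by rewrite mulr_natl.
Qed.

(** The local maps multiply the flattening only from outside, so it still factors through C^r for
    every [A]. *)
Lemma entS_act_unit_le r S (A : forall j : 'I_k, lin R 'I_r 'I_r) :
  act A (unit_tensor R k r) != [ffun=> 0] ->
  entS S (act A (unit_tensor R k r)) <= log2 r%:R.
Proof.
move=> /(trpow1_neq0 S); rewrite /entS fl_act fl_unit !mulmxA -mulmxA.
exact: entropy_le_inner.
Qed.

End Entropies.

(** * The lower quantum functional *)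

Section QuantumFunctional.
Variables (R : realType) (k : nat) (theta : bipartition k -> R).
Hypothesis theta_dist : is_dist theta.
Local Notation C := (complex R).
Local Open Scope sesquilinear_scope.
Implicit Types (I J L : 'I_k -> finType) (S : {set 'I_k}).

Lemma side_nontrivial (b : bipartition k) :
  side b != finset.set0 /\ ~: side b != finset.set0.
Proof.
rewrite /side; case: b => P /= /existsP[S /and3P[S0 SC0 /eqP ->]].
case: pickP => [S'|/(_ S)]; last by rewrite !inE eqxx.
by rewrite !inE => /orP[] /eqP -> /=; rewrite ?finset.setCK.
Qed.

(** Total weight 1 rules out an empty sum. The witness supplies a set with both sides nonempty,
    hence also a leg. *)
Lemma bipartition_exists : inhabited (bipartition k).
Proof.
case: (pickP (fun b : bipartition k => true)) => [b _|h]; first exact: inhabits b.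
have [_] := theta_dist; rewrite big_pred0 // => /esym/eqP.
by rewrite oner_eq0.
Qed.

Lemma HthetaE I (s : tensor R I) : Htheta theta s = \sum_b theta b * entS (side b) s.
Proof. by apply: eq_bigr => b _; rewrite ptrace_densityE. Qed.

Lemma theta_avg_le (f g : bipartition k -> R) : (forall b, f b <= g b) ->
  \sum_b theta b * f b <= \sum_b theta b * g b.
Proof. by move=> h; apply: ler_sum => b _; rewrite ler_wpM2l //; case: theta_dist. Qed.

Lemma theta_avg_const (c : R) : \sum_b theta b * c = c.
Proof. by rewrite -mulr_suml (proj2 theta_dist) mul1r. Qed.

Lemma Htheta_le I (s : tensor R I) : s != [ffun=> 0] ->
  Htheta theta s <=
  \sum_b theta b * log2 (minn (sdim I (side b)) (sdim I (~: side b)))%:R.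
Proof. by move=> s0; rewrite HthetaE; apply: theta_avg_le => b; exact: entS_le. Qed.

(** The dimension bound and the identity map confine the supremum between two reals, so later
    arguments can use a real least upper bound. *)
Lemma Etheta_spec I (s : tensor R I) : s != [ffun=> 0] ->
  exists e : R, [/\ Etheta theta s = e%:E,
    forall A, (forall j, A j \in unitmx) -> Htheta theta (act A s) <= e
  & forall c, (forall A, (forall j, A j \in unitmx) -> Htheta theta (act A s) <= c)
      -> e <= c].
Proof.
move=> s0; rewrite /Etheta (negPf s0); set X := (X in ereal_sup X).
have u1 : forall j : 'I_k, (1%:M : lin R (I j) (I j)) \in unitmx.
  by move=> j; rewrite unitmx1.
pose c0 := \sum_b theta b * log2 (minn (sdim I (side b)) (sdim I (~: side b)))%:R.
have ub : (ereal_sup X <= c0%:E)%E.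
  apply: ge_ereal_sup => _ [A /= uA <-]; rewrite lee_fin; apply: Htheta_le.
  exact: act_unit_neq0.
have lb : ((Htheta theta (act (fun j => 1%:M) s))%:E <= ereal_sup X)%E.
  by apply: ereal_sup_ubound; exists (fun j => 1%:M).
have [e eE] : exists e, ereal_sup X = e%:E.
  move: ub lb; case: (ereal_sup X) => [e _ _|//|//].
  by exists e.
exists e; split=> // [A uA|c hc].
  by rewrite -lee_fin -eE; apply: ereal_sup_ubound; exists A.
rewrite -lee_fin -eE; apply: ge_ereal_sup => _ [A /= uA <-].
by rewrite lee_fin; exact: hc.
Qed.

Lemma pow2E (x : R) : 2 `^ x = expR (x * ln 2).
Proof. by rewrite /powR pnatr_eq0. Qed.

Lemma pow2_gt0 (x : R) : 0 < 2 `^ x.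
Proof. by rewrite pow2E expR_gt0. Qed.

Lemma pow2_le (x y : R) : (2 `^ x <= 2 `^ y) = (x <= y).
Proof. by rewrite !pow2E ler_expR ler_pM2r // ln2_gt0. Qed.

Lemma log2K (c : R) : 0 < c -> 2 `^ (log2 c) = c.
Proof.
by move=> c0; rewrite pow2E /log2 divfK ?gt_eqF ?ln2_gt0 // lnK // posrE.
Qed.

(** * Limits, arbitrary local maps and degenerations *)

Lemma cvg_fl I S (u : nat -> tensor R I) (v : tensor R I) :
  (forall x, cvgC (fun n => u n x) (v x)) -> cvgmx (fun n => fl S (u n)) (fl S v).
Proof. by move=> h a b; under eq_fun do rewrite mxE; rewrite mxE. Qed.

(** There are finitely many bipartitions, so a single [n] works for all of them, and the common
    slack [e] averages to [e] under [theta]. Nonzero limits are approached by eventually nonzero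
    tensors. *)
Lemma Htheta_limit I (u : nat -> tensor R I) (v : tensor R I) c :
  (forall x, cvgC (fun n => u n x) (v x)) -> v != [ffun=> 0] ->
  (forall n, u n != [ffun=> 0] -> Htheta theta (u n) <= c) ->
  Htheta theta v <= c.
Proof.
move=> cu v0 hu; apply/ler_addgt0Pr => e e0.
have N0 S := trpow1_neq0 S v0.
have [n [hn un]] : exists n, (forall b, entS (side b) v - e <= entS (side b) (u n))
    /\ u n != [ffun=> 0].
  near (\oo%classic : set_system nat) => n; exists n; split.
    near: n; apply: filter_forall => b.
    exact: (entropy_lsc (N0 (side b)) (cvg_fl cu) e0).
  rewrite -normsq_eq0 (normsqE finset.set0); near: n.
  exact: (near_trpow1_neq0 (N0 finset.set0) (cvg_fl cu)).
rewrite -lerBlDr; apply: le_trans (hu n un).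
rewrite !HthetaE -[e]theta_avg_const -sumrB.
by under eq_bigr do rewrite -mulrBr; exact: theta_avg_le.
Unshelve. all: by end_near. Qed.

Lemma cvg_act I J (A : nat -> forall j, lin R (I j) (J j))
    (B : forall j, lin R (I j) (J j))
    (s : tensor R I) : (forall j, cvgmx (fun n => A n j) (B j)) ->
  forall y, cvgC (fun n => act (A n) s y) (act B s y).
Proof.
move=> h y; under eq_fun do rewrite ffunE; rewrite ffunE.
apply: cvgC_sum => x _; apply: cvgCM; last exact: cvgC_cst.
by apply: cvgC_prod => j _; exact: h.
Qed.

Lemma trpow_act_gram I J L (A : forall j, lin R (I j) (J j))
    (B : forall j, lin R (I j) (L j)) (s : tensor R I) S m :
  (forall j, adjlin (A j) *m A j = adjlin (B j) *m B j) ->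
  trpow (fl S (act A s)) m.+1 = trpow (fl S (act B s)) m.+1.
Proof.
move=> e; rewrite !fl_act.
have eg Q : (ktens A Q)^t* *m ktens A Q = (ktens B Q)^t* *m ktens B Q.
  by rewrite !ktens_adj !ktensM; exact: eq_ktens.
apply: trpow_gram; first exact: eg.
by rewrite !adj_trmx -!trmx_mul eg.
Qed.

Lemma Htheta_act_le I J (A : forall j, lin R (I j) (J j)) (s : tensor R I) c :
  (forall B, (forall j, B j \in unitmx) -> Htheta theta (act B s) <= c) ->
  act A s != [ffun=> 0] -> Htheta theta (act A s) <= c.
Proof.
move=> hc A0.
have sq j := cid (gram_square_root (A j)).
pose B j : lin R (I j) (I j) := sval (sq j).
have sq2 j := cid (svalP (sq j)).
pose U j : lin R (I j) (I j) := sval (sq2 j).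
have eB j : adjlin (A j) *m A j = adjlin (B j) *m B j.
  by have [h _] := svalP (sq2 j); rewrite /adjlin -h.
have uB j e : 0 < e -> B j + e%:C%C *: U j \in unitmx.
  by have [_ h] := svalP (sq2 j); exact: h.
have tE S m := trpow_act_gram s S m eB.
have B0 : act B s != [ffun=> 0].
  by rewrite -normsq_eq0 (normsqE finset.set0) -tE -normsqE normsq_eq0.
have -> : Htheta theta (act A s) = Htheta theta (act B s).
  rewrite !HthetaE; apply: eq_bigr => b _; congr (_ * _).
  apply: eq_entropy_nmom; rewrite ?trpow1_neq0 // => m.
  by rewrite /nmom !tE.
pose Bn (n : nat) j : lin R (I j) (I j) := B j + (n.+1%:R^-1)%:C%C *: U j.
apply: (@Htheta_limit _ (fun n => act (Bn n) s)) => // [x|n _].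
  apply: cvg_act => j a b.
  under eq_fun do rewrite /Bn !mxE.
  rewrite -[X in cvgC _ X]addr0 -(mul0r (U j a b)).
  apply: cvgCD; first exact: cvgC_cst.
  apply: cvgCM; last exact: cvgC_cst.
  by split => /=; [exact: cvg_harmonic|exact: cvg_cst].
by apply: hc => j; apply: uB; rewrite invr_gt0 ltr0n.
Qed.

Lemma Re_normsq I (s : tensor R I) :
  complex.Re (normsq s) = \sum_x (complex.Re (s x) ^+ 2 + complex.Im (s x) ^+ 2).
Proof.
rewrite /normsq (big_morph _ (@Re_add R) (erefl : complex.Re (0 : C) = 0)).
by apply: eq_bigr => x _; rewrite Re_mul Re_conjE Im_conjE mulrN opprK !expr2.
Qed.

Lemma ReIm_le_norm2 I (s : tensor R I) x :
  `|complex.Re (s x)| <= norm2 s /\ `|complex.Im (s x)| <= norm2 s.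
Proof.
have h : complex.Re (s x) ^+ 2 + complex.Im (s x) ^+ 2 <= complex.Re (normsq s).
  rewrite Re_normsq (bigD1 x) //= lerDl sumr_ge0 // => y _.
  by rewrite addr_ge0 ?sqr_ge0.
rewrite /norm2 -!sqrtr_sqr; split; apply: ler_wsqrtr; apply: le_trans h.
  by rewrite lerDl sqr_ge0.
by rewrite lerDr sqr_ge0.
Qed.

Lemma degenerates_seq I J (s : tensor R I) (t : tensor R J) : degenerates s t ->
  exists A : nat -> forall j, lin R (I j) (J j),
  forall y, cvgC (fun n => act (A n) s y) (t y).
Proof.
move=> h; have n0 (n : nat) : 0 < n.+1%:R^-1 :> R by rewrite invr_gt0 ltr0n.
have hA n := cid (h _ (n0 n)).
exists (fun n => sval (hA n)) => y.
have small n : `|complex.Re (t y) - complex.Re (act (sval (hA n)) s y)| < n.+1%:R^-1 /\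
    `|complex.Im (t y) - complex.Im (act (sval (hA n)) s y)| < n.+1%:R^-1.
  have lt := svalP (hA n); rewrite !(distrC (_ (t y))).
  have [] := ReIm_le_norm2 [ffun y => act (sval (hA n)) s y - t y] y.
  rewrite ffunE; set z := act _ _ _.
  have -> : complex.Re (z - t y) = complex.Re z - complex.Re (t y).
    by case: z (t y) => [? ?] [].
  have -> : complex.Im (z - t y) = complex.Im z - complex.Im (t y).
    by case: z (t y) => [? ?] [].
  by move=> a b; split; [exact: le_lt_trans a lt|exact: le_lt_trans b lt].
split; apply/cvgrPdist_lt => e e0; near=> n.
  apply: lt_trans (small n).1 _; near: n.
  exact: (near_infty_natSinv_lt (PosNum e0)).
apply: lt_trans (small n).2 _; near: n.
exact: (near_infty_natSinv_lt (PosNum e0)).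
Unshelve. all: by end_near. Qed.

Lemma Ftheta0 I : Ftheta theta ([ffun=> 0] : tensor R I) = 0%E.
Proof. by rewrite /Ftheta /Etheta eqxx. Qed.

Lemma Ftheta_ge0 I (s : tensor R I) : (0 <= Ftheta theta s)%E.
Proof. by rewrite /Ftheta; case: (Etheta theta s) => [r||] //=. Qed.

Lemma Ftheta_degenerates I J (s : tensor R I) (t : tensor R J) :
  degenerates s t -> (Ftheta theta t <= Ftheta theta s)%E.
Proof.
move=> /degenerates_seq[A cA].
have [->|t0] := eqVneq t [ffun=> 0]; first by rewrite Ftheta0 Ftheta_ge0.
(* For invertible [B], [act B t] is the limit of the images of [s] under [B j *m A n j]. The
   restriction to nonzero [act B s] makes the premise vacuous when [s] is zero, which is exploited
   next. *)
have bound c : (forall B, (forall j, B j \in unitmx) -> act B s != [ffun=> 0] ->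
    Htheta theta (act B s) <= c) ->
    forall B, (forall j, B j \in unitmx) -> Htheta theta (act B t) <= c.
  move=> hc B uB.
  apply: (@Htheta_limit _ (fun n => act (fun j => B j *m A n j) s)) => [y||n hn].
  - under eq_fun do rewrite -act_comp.
    under eq_fun do rewrite ffunE; rewrite ffunE.
    by apply: cvgC_sum => x _; apply: cvgCM; [exact: cvgC_cst|exact: cA].
  - exact: act_unit_neq0.
  - apply: Htheta_act_le => // B' uB'; apply: hc => //.
    apply: contraNneq hn => h0; apply/eqP.
    have s0 : s = [ffun=> 0].
      by apply: contra_eq h0; exact: act_unit_neq0.
    by rewrite s0 act0.
have s0 : s != [ffun=> 0].
  apply/eqP => s0.
  (* If [s] were zero, [bound] would hold for every real c; this value contradicts it at the
     identity map. *)
  have : Htheta theta t <= Htheta theta t - 1.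
    rewrite -{1}[t]act1; apply: bound => [B _|j]; last exact: unitmx1.
    by rewrite s0 act0 eqxx.
  by rewrite lerBrDr gerDl ler10.
have [es [eE ub _]] := Etheta_spec s0.
have [et [eE' _ lub]] := Etheta_spec t0.
rewrite /Ftheta eE eE' /= lee_fin pow2_le; apply: lub; apply: bound => B uB _.
exact: ub.
Qed.

Lemma norm2_0 I (s : tensor R I) : norm2 [ffun y => s y - s y] = 0.
Proof.
rewrite /norm2 Re_normsq big1 ?sqrtr0 // => x _.
by rewrite ffunE subrr expr0n addr0.
Qed.

Lemma Ftheta_act I J (A : forall j, lin R (I j) (J j)) (s : tensor R I) :
  (Ftheta theta (act A s) <= Ftheta theta s)%E.
Proof. by apply: Ftheta_degenerates => e e0; exists A; rewrite norm2_0. Qed.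

(** * Superadditivity under direct sums *)

Lemma k_gt0 : (0 < k)%N.
Proof.
have [b] := bipartition_exists; have [/set0Pn[j _] _] := side_nontrivial b.
exact: leq_trans (ltn_ord j).
Qed.

(** With no legs the empty product of coefficients would be 1; [k_gt0] supplies a zero factor. *)
Lemma act_zero I J (s : tensor R I) :
  act (fun j => 0 : lin R (I j) (J j)) s = [ffun=> 0].
Proof.
apply/ffunP => y; rewrite !ffunE big1 // => x _.
by rewrite (bigD1 (Ordinal k_gt0)) //= mxE !mul0r.
Qed.

Lemma act_dsum_l I J (s : tensor R I) (t : tensor R J) :
  act (fun j => adjlin (il R I J j)) (dsum s t) = s.
Proof.
rewrite dsumE actD !act_comp.
have -> : (fun j => adjlin (il R I J j) *m il R I J j) = fun j => 1%:M.
  by apply: functional_extensionality_dep => j; exact: ilil.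
have -> : (fun j => adjlin (il R I J j) *m ir R I J j) = fun j => 0.
  by apply: functional_extensionality_dep => j; exact: ilir.
by apply/ffunP => x; rewrite ffunE act1 act_zero ffunE addr0.
Qed.

Lemma act_dsum_r I J (s : tensor R I) (t : tensor R J) :
  act (fun j => adjlin (ir R I J j)) (dsum s t) = t.
Proof.
rewrite dsumE actD !act_comp.
have -> : (fun j => adjlin (ir R I J j) *m ir R I J j) = fun j => 1%:M.
  by apply: functional_extensionality_dep => j; exact: irir.
have -> : (fun j => adjlin (ir R I J j) *m il R I J j) = fun j => 0.
  by apply: functional_extensionality_dep => j; exact: iril.
by apply/ffunP => x; rewrite ffunE act1 act_zero ffunE add0r.
Qed.

Lemma flZ I S (c : C) (s : tensor R I) : fl S [ffun x => c * s x] = c *: fl S s.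
Proof. by apply/matrixP => a b; rewrite !mxE ffunE. Qed.

Lemma HthetaZ I (c : C) (s : tensor R I) : c != 0 ->
  Htheta theta [ffun x => c * s x] = Htheta theta s.
Proof.
by move=> c0; rewrite !HthetaE; apply: eq_bigr => b _; rewrite /entS flZ mxdenZ.
Qed.

Lemma nsqZ I (c : R) (s : tensor R I) :
  nsq [ffun x => c%:C%C * s x] = c ^+ 2 * nsq s.
Proof.
rewrite /nsq !Re_normsq mulr_sumr; apply: eq_bigr => x _.
by rewrite ffunE Re_mul Im_mul /= !mul0r subr0 addr0 !exprMn mulrDr.
Qed.

(** The scalar is put entirely on one leg, so no k-th root is taken. *)
Lemma act_scaled I J (c : C) (A : forall j, lin R (I j) (J j)) (s : tensor R I) :
  [ffun x => c * act A s x] =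
  act (fun j => (if j == Ordinal k_gt0 then c else 1) *: A j) s.
Proof.
apply/ffunP => y; rewrite !ffunE mulr_sumr; apply: eq_bigr => x _.
rewrite mulrA; congr (_ * _); under [RHS]eq_bigr do rewrite mxE.
rewrite big_split /=; congr (_ * _).
by rewrite (bigD1 (Ordinal k_gt0)) //= big1 ?mulr1 // => j /negPf ->.
Qed.

(** Entropies ignore scalars, so the squared norm can be prescribed freely within the GL orbit; this
    is the freedom used to tune the mixing weight. *)
Lemma scale_orbit I (A : forall j, lin R (I j) (I j)) (s : tensor R I) (c : R) :
  (forall j, A j \in unitmx) -> s != [ffun=> 0] -> 0 < c ->
  exists A' : forall j, lin R (I j) (I j), [/\ forall j, A' j \in unitmx,
    Htheta theta (act A' s) = Htheta theta (act A s) & nsq (act A' s) = c].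
Proof.
move=> uA s0 c0; have n0 := nsq_gt0 (act_unit_neq0 uA s0).
pose d := Num.sqrt (c / nsq (act A s)).
have d0 : 0 < d by rewrite sqrtr_gt0 divr_gt0.
have dC : d%:C%C != 0 :> C.
  by apply: contraTneq d0 => /complexI ->; rewrite ltxx.
exists (fun j => (if j == Ordinal k_gt0 then d%:C%C else 1) *: A j).
rewrite -act_scaled; split.
- move=> j; rewrite unitmxZ ?uA // unitfE.
  by case: (j == _); rewrite ?oner_neq0.
- exact: HthetaZ.
- by rewrite nsqZ sqr_sqrtr ?divfK ?gt_eqF // divr_ge0 ?ltW.
Qed.

Lemma dsum_neq0 I J (s : tensor R I) (t : tensor R J) :
  s != [ffun=> 0] -> dsum s t != [ffun=> 0].
Proof.
by apply: contraNneq => h; rewrite -(act_dsum_l s t) h act0.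
Qed.

(** With weights proportional to 2^a and 2^b, minus log2 of each weight is log2(2^a + 2^b) less a or
    b. These terms cancel the averaged entropies and leave log2(2^a + 2^b). *)
Lemma Htheta_dsum I J (s : tensor R I) (t : tensor R J) :
  s != [ffun=> 0] -> t != [ffun=> 0] ->
  nsq s = 2 `^ Htheta theta s -> nsq t = 2 `^ Htheta theta t ->
  2 `^ Htheta theta (dsum s t) = 2 `^ Htheta theta s + 2 `^ Htheta theta t.
Proof.
move=> s0 t0 ns nt; set a := Htheta theta s in ns *; set b := Htheta theta t in nt *.
have a0 := pow2_gt0 a; have b0 := pow2_gt0 b.
have z0 : 0 < 2 `^ a + 2 `^ b by rewrite addr_gt0.
pose p := nsq s / (nsq s + nsq t).
have pE : p = 2 `^ a / (2 `^ a + 2 `^ b) by rewrite /p ns nt.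
have qE : 1 - p = 2 `^ b / (2 `^ a + 2 `^ b) by rewrite pE; field; rewrite gt_eqF.
rewrite -[RHS]log2K //; congr (2 `^ _).
transitivity (p * a + (1 - p) * b + (shannon p + shannon (1 - p)) / ln 2).
  rewrite !HthetaE /a /b !HthetaE !mulr_sumr -[X in _ + X]theta_avg_const -!big_split /=.
  apply: eq_bigr => c _; have [S0 SC0] := side_nontrivial c.
  rewrite (entS_dsum S0 SC0 s0 t0 (erefl p)); ring.
have l2 : ln 2 != 0 :> R by rewrite gt_eqF // ln2_gt0.
have shE (x y : R) : 0 < y ->
    shannon (2 `^ x / y) / ln 2 = 2 `^ x / y * (log2 y - x).
  move=> y0; rewrite /shannon ln_div ?posrE ?pow2_gt0 // ln_powR /log2.
  have yn0 : y != 0 by rewrite gt_eqF.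
  by field; rewrite l2 yn0.
rewrite [X in _ + X]mulrDl qE pE !shE //.
by field; rewrite gt_eqF.
Qed.

Lemma Ftheta_dsum I J (s : tensor R I) (t : tensor R J) :
  (Ftheta theta s + Ftheta theta t <= Ftheta theta (dsum s t))%E.
Proof.
(* If one summand is zero, local projections still send the direct sum to the other, and
   monotonicity suffices. *)
have [s0|s0] := eqVneq s [ffun=> 0].
  by rewrite {1}s0 Ftheta0 add0e -{1}(act_dsum_r s t) Ftheta_act.
have [t0|t0] := eqVneq t [ffun=> 0].
  by rewrite {1}t0 Ftheta0 adde0 -{1}(act_dsum_l s t) Ftheta_act.
have [es [eE _ lubs]] := Etheta_spec s0.
have [et [eE' _ lubt]] := Etheta_spec t0.
have [eu [eE'' ub _]] := Etheta_spec (dsum_neq0 t s0).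
rewrite /Ftheta eE eE' eE'' /= -EFinD lee_fin.
have key A B : (forall j, A j \in unitmx) -> (forall j, B j \in unitmx) ->
   2 `^ Htheta theta (act A s) + 2 `^ Htheta theta (act B t) <= 2 `^ eu.
  move=> uA uB.
  have [A' [uA' hA nA]] := scale_orbit uA s0 (pow2_gt0 (Htheta theta (act A s))).
  have [B' [uB' hB nB]] := scale_orbit uB t0 (pow2_gt0 (Htheta theta (act B t))).
  have nsA : nsq (act A' s) = 2 `^ Htheta theta (act A' s) by rewrite nA hA.
  have nsB : nsq (act B' t) = 2 `^ Htheta theta (act B' t) by rewrite nB hB.
  have := Htheta_dsum (act_unit_neq0 uA' s0) (act_unit_neq0 uB' t0) nsA nsB.
  rewrite hA hB => <-; rewrite pow2_le -act_dsum.
  by apply: ub => j; exact: dslin_unit.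
have keyt A : (forall j, A j \in unitmx) ->
   2 `^ Htheta theta (act A s) + 2 `^ et <= 2 `^ eu.
  move=> uA; rewrite -lerBrDl.
  (* The two suprema are taken one after the other. Positivity of the difference, obtained from the
     identity map, lets it be written as a power of 2, so that the supremum over [B] is taken in the
     exponent. *)
  have p0 : 0 < 2 `^ eu - 2 `^ Htheta theta (act A s).
    apply: lt_le_trans (pow2_gt0 (Htheta theta (act (fun j => 1%:M) t))) _.
    by rewrite lerBrDl; apply: key => // j; exact: unitmx1.
  rewrite -(log2K p0) pow2_le; apply: lubt => B uB.
  by rewrite -pow2_le log2K // lerBrDl key.
rewrite -lerBrDr.
have p0 : 0 < 2 `^ eu - 2 `^ et.
  apply: lt_le_trans (pow2_gt0 (Htheta theta (act (fun j => 1%:M) s))) _.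
  by rewrite lerBrDr; apply: keyt => j; exact: unitmx1.
rewrite -(log2K p0) pow2_le; apply: lubs => A uA.
by rewrite -pow2_le log2K // lerBrDr keyt.
Qed.

(** * Tensor products, the dimension bound and unit tensors *)

Lemma tprod_neq0 I J (s : tensor R I) (t : tensor R J) :
  s != [ffun=> 0] -> t != [ffun=> 0] -> tprod s t != [ffun=> 0].
Proof.
move=> s0 t0; rewrite -normsq_eq0 (normsqE finset.set0) trpow_tprod.
by rewrite mulf_neq0 // trpow1_neq0.
Qed.

Lemma Ftheta_tprod I J (s : tensor R I) (t : tensor R J) :
  (Ftheta theta s * Ftheta theta t <= Ftheta theta (tprod s t))%E.
Proof.
have [s0|s0] := eqVneq s [ffun=> 0]; first by rewrite {1}s0 Ftheta0 mul0e Ftheta_ge0.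
have [t0|t0] := eqVneq t [ffun=> 0]; first by rewrite {1}t0 Ftheta0 mule0 Ftheta_ge0.
have [es [eE _ lubs]] := Etheta_spec s0.
have [et [eE' _ lubt]] := Etheta_spec t0.
have [eu [eE'' ub _]] := Etheta_spec (tprod_neq0 s0 t0).
rewrite /Ftheta eE eE' eE'' /= -EFinM lee_fin -powRD ?pnatr_eq0 ?implybT // pow2_le.
rewrite -lerBrDr; apply: lubs => A uA; rewrite lerBrDr -lerBrDl; apply: lubt => B uB.
rewrite lerBrDl; apply: le_trans (ub (fun j => tplin (A j) (B j)) _); last first.
  by move=> j; apply: tplin_unit; [exact: uA|exact: uB].
rewrite act_tprod !HthetaE -big_split /=; apply: ler_sum => b _.
by rewrite entS_tprod ?mulrDr // act_unit_neq0.
Qed.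

Lemma Ftheta_le I (s : tensor R I) : (Ftheta theta s <=
  (\prod_(b : bipartition k)
     (minn (sdim I (side b)) (sdim I (~: side b)))%:R `^ theta b)%:E)%E.
Proof.
have [->|s0] := eqVneq s [ffun=> 0].
  by rewrite Ftheta0 lee_fin; apply: prodr_ge0 => b _; exact: powR_ge0.
have [es [eE _ lubs]] := Etheta_spec s0.
rewrite /Ftheta eE /= lee_fin.
have -> : \prod_b (minn (sdim I (side b)) (sdim I (~: side b)))%:R `^ theta b =
   2 `^ (\sum_b theta b * log2 (minn (sdim I (side b)) (sdim I (~: side b)))%:R).
  rewrite pow2E mulr_suml expR_sum; apply: eq_bigr => b _.
  (* A nonzero tensor has nonempty index types, so the bases are positive and [powR] takes its
     exponential branch. *)
  rewrite /powR pnatr_eq0 gtn_eqF; last by rewrite leq_min !(sdim_gt0 _ s0).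
  by rewrite /log2 mulrA divfK // gt_eqF // ln2_gt0.
rewrite pow2_le; apply: lubs => A uA; apply: Htheta_le.
exact: act_unit_neq0.
Qed.

Lemma Ftheta_unit r : Ftheta theta (unit_tensor R k r) = r%:R%:E.
Proof.
have [b0] := bipartition_exists; have [S0 SC0] := side_nontrivial b0.
have [->|r0] := posnP r.
  have -> : unit_tensor R k 0 = [ffun=> 0].
    by apply/ffunP => x; rewrite !ffunE big_ord0.
  by rewrite Ftheta0.
have u0 : unit_tensor R k r != [ffun=> 0].
  by rewrite -normsq_eq0 (normsqE (side b0)) trpow_unit // pnatr_eq0 -lt0n.
have [e [eE ub lub]] := Etheta_spec u0.
rewrite /Ftheta eE /=; congr (_%:E).
suff -> : e = log2 r%:R by rewrite log2K // ltr0n.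
apply/eqP; rewrite eq_le; apply/andP; split.
  apply: lub => A uA; rewrite HthetaE -[leRHS]theta_avg_const.
  by apply: theta_avg_le => b; apply: entS_act_unit_le; exact: act_unit_neq0.
have := ub (fun j => 1%:M) (fun j => unitmx1 _ _).
rewrite act1 HthetaE; apply: le_trans; rewrite -[leLHS]theta_avg_const.
apply: theta_avg_le => b; have [? ?] := side_nontrivial b.
by rewrite entS_unit.
Qed.

End QuantumFunctional.

Theorem theorem3p19 (R : realType) (k : nat) (hk : (3 <= k)%N)
    (theta : bipartition k -> R) (htheta : is_dist theta)
    (I J : 'I_k -> finType) (s : tensor R I) (t : tensor R J) :
  (forall r : nat, Ftheta theta (unit_tensor R k r) = r%:R%:E)
  /\ (Ftheta theta s + Ftheta theta t <= Ftheta theta (dsum s t))%E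
  /\ (Ftheta theta s * Ftheta theta t <= Ftheta theta (tprod s t))%E
  /\ (degenerates s t -> (Ftheta theta t <= Ftheta theta s)%E)
  /\ (0 <= Ftheta theta s)%E
  /\ (Ftheta theta s <=
      (\prod_(b : bipartition k)
         (minn (sdim I (side b)) (sdim I (~: side b)))%:R `^ theta b)%:E)%E.
Proof.
split; first by move=> r; exact: Ftheta_unit.
split; first exact: Ftheta_dsum.
split; first exact: Ftheta_tprod.
split; first exact: Ftheta_degenerates.
split; first exact: Ftheta_ge0.
exact: Ftheta_le.
Qed.
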